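(* Let $n\ge2$, let $\mathsf{s}=\operatorname{diag}(1,0,\dots,0)\in\mathfrak{gl}_n(\mathbb{C})$, and let $\mathsf{s}_t=t\,\mathsf{s}+E_{1n}\in M_n(\mathbb{C}[t])$. For any Hessenberg function $h:[n]\to[n]$, $$\mathcal{I}_{\mathsf{s}_t,h}=\bigcap_{i\in\mathcal{C}(h)}\mathcal{P}^t_{i,h}.$$ In particular, $\tilde{\mathcal{I}}_{\mathsf{s}_t,h}=\mathcal{I}_{\mathsf{s}_t,h}$, the affine scheme $\mathcal{Y}_{\mathsf{s}_t,h}=\operatorname{Spec}\mathbb{C}[t,\mathbf{z}]/\tilde{\mathcal{I}}_{\mathsf{s}_t,h}$ is reduced, and $\{\mathcal{P}^t_{i,h}\mid i\in\mathcal{C}(h)\}$ is the set of associated primes of $\tilde{\mathcal{I}}_{\mathsf{s}_t,h}$.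
   Context: Let $[n]=\{1,\dots,n\}$. A Hessenberg function is a map $h:[n]\to[n]$ with $h(i)\le h(i+1)$ for $i<n$ and $h(i)\ge i$ for all $i$; set $h(0)=0$. The set of corners of $h$ is $\mathcal{C}(h)=\{i\in[n]\mid h(i)>h(i-1)\}$. $E_{ij}$ is the matrix unit. Let $\mathbf{z}=\{z_{ij}\mid 1\le i,j\le n\}$, $Z=(z_{ij})$, $d=\det Z$, and let $v_j=\sum_i z_{ij}e_i$ be the $j$-th column of $Z$. For $\mathsf{x}\in M_n(\mathbb{C}[t])$ and each $i$ with $h(i)<n$ let $\mathcal{I}_{\mathsf{x},h,i}\subseteq\mathbb{C}[t,\mathbf{z}]$ be the ideal generated by all $(h(i)+1)\times(h(i)+1)$ minors of the $n\times(i+h(i))$ matrix $[\mathsf{x}v_1\ \cdots\ \mathsf{x}v_i\ v_1\ \cdots\ v_{h(i)}]$, and $\mathcal{I}_{\mathsf{x},h,i}=0$ if $h(i)=n$. Put $\mathcal{I}_{\mathsf{x},h}=\sum_{i\in[n]}\mathcal{I}_{\mathsf{x},h,i}$ and let $\tilde{\mathcal{I}}_{\mathsf{x},h}=\{f\in\mathbb{C}[t,\mathbf{z}]\mid d^kf\in\mathcal{I}_{\mathsf{x},h}\text{ for some }k\ge0\}$. For $i,j\in[n]$ define ideals of $\mathbb{C}[t,\mathbf{z}]$: $\mathcal{J}^t_i=\langle tz_{11}+z_{n1},\dots,tz_{1i}+z_{ni}\rangle$, $\mathcal{J}^t_0=\langle0\rangle$, and $\mathcal{K}_j=\langle p_B\mid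 B\subseteq\{2,\dots,n\},\ |B|=j\rangle$, where $p_B$ is the determinant of the submatrix $(z_{k\ell})_{k\in B,\,1\le\ell\le j}$ (so $\mathcal{K}_n=\langle0\rangle$). Set $\mathcal{P}^t_{i,h}=\mathcal{J}^t_{i-1}+\mathcal{K}_{h(i)}$. *)

(* Defs.v *)
From HB Require Import structures.
From mathcomp Require Import all_boot all_order all_algebra.
From mathcomp Require Import boolp classical_sets reals.
From mathcomp Require Import complex mpoly.
Set Implicit Arguments.
Unset Strict Implicit.
Unset Printing Implicit Defensive.
Import Order.TTheory GRing.Theory Num.Theory.
Local Open Scope ring_scope.
Local Open Scope classical_set_scope.
Local Open Scope quotient_scope.
Local Open Scope complex_scope.

(* The library ideals [idealr] are proper and live in nontrivial rings; here the
   unit ideal and the zero ring have to be allowed. *)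
Definition is_ideal (A : comPzRingType) (I : set A) : Prop :=
  [/\ I 0, forall a b, I a -> I b -> I (a + b) & forall c a, I a -> I (c * a)].

Definition ideal_gen (A : comPzRingType) (S : set A) : set A :=
  smallest (@is_ideal A) S.

Definition ideal_add (A : comPzRingType) (I J : set A) : set A :=
  [set a + b | a in I & b in J].

Definition ideal_sat (A : comPzRingType) (d : A) (I : set A) : set A :=
  [set f | exists k : nat, I (d ^+ k * f)].

Definition is_prime (A : comPzRingType) (P : set A) : Prop :=
  [/\ is_ideal P, ~ P 1 & forall a b, P (a * b) -> P a \/ P b].

(* Associated primes of the module A / I: the primes that are annihilators
   (I : f) of the class of some element f. *)
Definition associated_primes (A : comPzRingType) (I : set A) : set (set A) :=
  [set P | is_prime P /\ exists f : A, P = [set g | I (g * f)]].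

Lemma ideal_gen_ideal (A : comPzRingType) (S : set A) : is_ideal (ideal_gen S).
Proof.
split=> [I [[I0 _ _] _] //|a b Ia Ib I HI|c a Ia I HI].
  by have [[_ ID _] _] := HI; apply: ID; [apply: Ia|apply: Ib].
by have [[_ _ IM] _] := HI; apply: IM; apply: Ia.
Qed.

Lemma ideal_zero_ideal (A : comPzRingType) : is_ideal [set 0 : A].
Proof.
by split=> [//|a b /= -> ->|c a /= ->]; rewrite ?addr0 ?mulr0.
Qed.

Lemma ideal_add_ideal (A : comPzRingType) (I J : set A) :
  is_ideal I -> is_ideal J -> is_ideal (ideal_add I J).
Proof.
move=> [I0 ID IM] [J0 JD JM]; split=> [|_ _ [a Ia [b Jb <-]] [c Ic [d Jd <-]]|].
- by exists 0 => //; exists 0 => //; rewrite addr0.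
- by exists (a + c); [exact: ID|exists (b + d); [exact: JD|rewrite addrACA]].
- move=> c _ [a Ia [b Jb <-]]; exists (c * a); first exact: IM.
  by exists (c * b); [exact: JM|rewrite mulrDr].
Qed.

Lemma ideal_sat_ideal (A : comPzRingType) (d : A) (I : set A) :
  is_ideal I -> is_ideal (ideal_sat d I).
Proof.
move=> [I0 ID IM]; split=> [|a b [k Ia] [l Ib]|c a [k Ia]].
- by exists 0%N; rewrite mulr0.
- exists (l + k)%N; rewrite mulrDr; apply: ID.
    by rewrite exprD -mulrA; apply: IM.
  by rewrite addnC exprD -mulrA; apply: IM.
- by exists k; rewrite mulrCA; apply: IM.
Qed.

(* The library only builds a ring structure on quotients by proper ideals. *)
Record ideal (A : comPzRingType) :=
  Ideal { ideal_set : set A; idealP : is_ideal ideal_set }.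

Definition ideal_pred (A : comPzRingType) (I : ideal A) : A -> bool :=
  fun a => `[< ideal_set I a >].

Lemma ideal_pred_zmod_closed (A : comPzRingType) (I : ideal A) :
  zmod_closed (ideal_pred I).
Proof.
have [I0 ID IM] := idealP I.
split=> [|a b /asboolP Ia /asboolP Ib]; apply/asboolP => //.
by apply: ID => //; rewrite -mulN1r; apply: IM.
Qed.

HB.instance Definition _ (A : comPzRingType) (I : ideal A) :=
  GRing.isZmodClosed.Build A (ideal_pred I) (ideal_pred_zmod_closed I).

Definition ideal_zmodClosed (A : comPzRingType) (I : ideal A) : zmodClosed A :=
  GRing.ZmodClosed.clone A (ideal_pred I) _.

Definition quotient_ring (A : comPzRingType) (I : ideal A) : Type :=
  Quotient.quot (ideal_zmodClosed I).

HB.instance Definition _ (A : comPzRingType) (I : ideal A) :=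
  GRing.Zmodule.on (quotient_ring I).

Definition quot_class (A : comPzRingType) (I : ideal A) (a : A) :
  quotient_ring I := \pi_(Quotient.quot (ideal_zmodClosed I)) a.

Definition quot_repr (A : comPzRingType) (I : ideal A) (x : quotient_ring I) :
  A := repr (x : Quotient.quot (ideal_zmodClosed I)).

Definition quot_one (A : comPzRingType) (I : ideal A) : quotient_ring I :=
  quot_class I 1.

Definition quot_mul (A : comPzRingType) (I : ideal A) (x y : quotient_ring I) :
  quotient_ring I := quot_class I (quot_repr x * quot_repr y).

Lemma quot_reprK (A : comPzRingType) (I : ideal A) :
  cancel (@quot_repr A I) (quot_class I).
Proof. by move=> x; exact: reprK. Qed.

Lemma quot_classP (A : comPzRingType) (I : ideal A) (a b : A) :
  quot_class I a = quot_class I b <-> ideal_set I (a - b).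
Proof.
have -> : ideal_set I (a - b) <-> (a - b) \in ideal_zmodClosed I.
  by split=> [?|/asboolP //]; apply/asboolP.
by rewrite Quotient.idealrBE; split=> [eq_ab|/eqP //]; apply/eqP.
Qed.

Lemma quot_classD (A : comPzRingType) (I : ideal A) :
  {morph quot_class I : a b / a + b}.
Proof. exact: Quotient.pi_add. Qed.

Lemma quot_classM (A : comPzRingType) (I : ideal A) (a b : A) :
  quot_class I (a * b) = quot_mul (quot_class I a) (quot_class I b).
Proof.
have [I0 ID IM] := idealP I.
have repr_sub c : ideal_set I (c - quot_repr (quot_class I c)).
  by apply/quot_classP; rewrite quot_reprK.
apply/quot_classP; set a' := quot_repr _; set b' := quot_repr _.
have -> : a * b - a' * b' = b * (a - a') + a' * (b - b').
  by rewrite !mulrBr (mulrC b a) (mulrC b a') addrA subrK.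
by apply: ID; apply: IM; apply: repr_sub.
Qed.

Lemma quot_mulA (A : comPzRingType) (I : ideal A) :
  associative (@quot_mul A I).
Proof.
move=> x y z; rewrite -[x]quot_reprK -[y]quot_reprK -[z]quot_reprK.
by rewrite -!quot_classM mulrA.
Qed.

Lemma quot_mulC (A : comPzRingType) (I : ideal A) :
  commutative (@quot_mul A I).
Proof. by move=> x y; rewrite /quot_mul mulrC. Qed.

Lemma quot_mul1r (A : comPzRingType) (I : ideal A) :
  left_id (quot_one I) (@quot_mul A I).
Proof. by move=> x; rewrite -[x]quot_reprK -quot_classM mul1r. Qed.

Lemma quot_mulDl (A : comPzRingType) (I : ideal A) :
  left_distributive (@quot_mul A I) +%R.
Proof.
move=> x y z; rewrite -[x]quot_reprK -[y]quot_reprK -[z]quot_reprK.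
by rewrite -quot_classD -!quot_classM mulrDl quot_classD.
Qed.

HB.instance Definition _ (A : comPzRingType) (I : ideal A) :=
  GRing.Zmodule_isComPzRing.Build (quotient_ring I)
    (@quot_mulA A I) (@quot_mulC A I) (@quot_mul1r A I) (@quot_mulDl A I).

(* Equality of the fractions a / s and b / t in the localization of [A] at the
   complement of the prime ideal [P]. *)
Definition eq_frac_at (A : comPzRingType) (P : set A) (a s b t : A) : Prop :=
  exists u : A, ~ P u /\ u * (a * t - b * s) = 0.

(* Spec A is a reduced scheme: at every point P the local ring A_P has no
   nonzero nilpotent element, that is, (a / s)^k = 0 in A_P implies
   a / s = 0 in A_P. *)
Definition reduced_Spec (A : comPzRingType) : Prop :=
  forall P : set A, is_prime P ->
  forall (a s : A) (k : nat), ~ P s ->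
    eq_frac_at P (a ^+ k) (s ^+ k) 0 1 -> eq_frac_at P a s 0 1.

(* Indices follow the 1-based numbering of the mathematics: functions on
   {1, ..., n} and the subscripts of z are natural numbers, and only the rows
   and columns of matrices are numbered from 0. *)

(* The variable of index 0 is t and, for 1 <= i, j <= n, the variable of index
   (i - 1) n + j is z_ij. *)
Definition Ctz (R : realType) (n : nat) : comNzRingType :=
  {mpoly R[i][(n * n).+1]}.

Definition tvar (R : realType) (n : nat) : Ctz R n := 'X_ord0.

Definition zvar (R : realType) (n i j : nat) : Ctz R n :=
  'X_(inord (i.-1 * n + j)%N).

(* [v_1 ... v_k], the first k columns of the generic matrix Z. *)
Definition zcols (R : realType) (n k : nat) : 'M[Ctz R n]_(n, k) :=
  \matrix_(a < n, b < k) zvar R n a.+1 b.+1.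

Definition zdet (R : realType) (n : nat) : Ctz R n := \det (zcols R n n).

Definition Ct_in_Ctz (R : realType) (n : nat) (p : {poly R[i]}) : Ctz R n :=
  (map_poly (@mpolyC (n * n).+1 R[i]) p).[tvar R n].

Definition hessenberg (n : nat) (h : nat -> nat) : Prop :=
  [/\ h 0 = 0,
      forall i, 1 <= i <= n -> 1 <= h i <= n,
      forall i, 1 <= i < n -> h i <= h i.+1 &
      forall i, 1 <= i <= n -> i <= h i]%N.

Definition corners (n : nat) (h : nat -> nat) : set nat :=
  [set i | 1 <= i <= n /\ h i > h i.-1]%N.

Definition minors (A : comPzRingType) (m p r : nat) (M : 'M[A]_(m, p)) : set A :=
  [set f | exists (rows : 'I_r -> 'I_m) (cols : 'I_r -> 'I_p),
    [/\ {homo rows : a b / (a < b)%N}, {homo cols : a b / (a < b)%N}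
      & f = \det (mxsub rows cols M)]].

(* The matrix [x v_1 ... x v_i  v_1 ... v_k]. *)
Definition hess_matrix (R : realType) (n : nat) (x : 'M[{poly R[i]}]_n)
    (i k : nat) : 'M[Ctz R n]_(n, i + k) :=
  row_mx (map_mx (@Ct_in_Ctz R n) x *m zcols R n i) (zcols R n k).

Definition hess_ideal_at (R : realType) (n : nat) (x : 'M[{poly R[i]}]_n)
    (h : nat -> nat) (i : nat) : set (Ctz R n) :=
  if (h i < n)%N then ideal_gen (minors (h i).+1 (hess_matrix x i (h i)))
  else [set 0].

Definition hess_ideal (R : realType) (n : nat) (x : 'M[{poly R[i]}]_n)
    (h : nat -> nat) : set (Ctz R n) :=
  \big[@ideal_add (Ctz R n)/[set 0]]_(1 <= i < n.+1) hess_ideal_at x h i.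

Definition hess_ideal_sat (R : realType) (n : nat) (x : 'M[{poly R[i]}]_n)
    (h : nat -> nat) : set (Ctz R n) :=
  ideal_sat (zdet R n) (hess_ideal x h).

Lemma hess_ideal_at_ideal (R : realType) (n : nat) (x : 'M[{poly R[i]}]_n)
    (h : nat -> nat) (i : nat) : is_ideal (hess_ideal_at x h i).
Proof.
by rewrite /hess_ideal_at; case: ifP => _;
  [exact: ideal_gen_ideal|exact: ideal_zero_ideal].
Qed.

Lemma hess_ideal_sat_ideal (R : realType) (n : nat) (x : 'M[{poly R[i]}]_n)
    (h : nat -> nat) : is_ideal (hess_ideal_sat x h).
Proof.
apply: ideal_sat_ideal; apply: big_ind => [||i _].
- exact: ideal_zero_ideal.
- exact: ideal_add_ideal.
- exact: hess_ideal_at_ideal.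
Qed.

Definition hess_coord_ring (R : realType) (n : nat) (x : 'M[{poly R[i]}]_n)
    (h : nat -> nat) : comPzRingType :=
  quotient_ring (Ideal (hess_ideal_sat_ideal x h)).

Definition smx (R : realType) (n : nat) : 'M[R[i]]_n :=
  diag_mx (\row_(a < n) (a == 0%N :> nat)%:R).

Definition E1n (R : realType) (n : nat) : 'M[{poly R[i]}]_n :=
  \matrix_(a < n, b < n) ((a == 0%N :> nat) && (b.+1 == n :> nat))%:R.

Definition st (R : realType) (n : nat) : 'M[{poly R[i]}]_n :=
  'X *: map_mx polyC (smx R n) + E1n R n.

Definition Jt (R : realType) (n i : nat) : set (Ctz R n) :=
  ideal_gen [set tvar R n * zvar R n 1 l + zvar R n n l
            | l in [set l | 1 <= l <= i]%N].

(* A set B of row indices is given by its increasing enumeration. *)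
Arguments Jt : clear implicits.

Definition pB (R : realType) (n : nat) (B : seq nat) : Ctz R n :=
  \det (\matrix_(a < size B, b < size B) zvar R n (nth 0%N B a) b.+1).

Definition K (R : realType) (n j : nat) : set (Ctz R n) :=
  ideal_gen [set pB R n B
            | B in [set B | [/\ sorted ltn B, {in B, forall k, 2 <= k <= n}
                              & size B = j]]%N].

Arguments K : clear implicits.

Definition Pt (R : realType) (n : nat) (h : nat -> nat) (i : nat) :
  set (Ctz R n) := ideal_add (Jt R n i.-1) (K R n (h i)).
Arguments Pt : clear implicits.

(* Main.v *)
Require Import Defs.
From HB Require Import structures.
From mathcomp Require Import all_boot all_order all_algebra.
From mathcomp Require Import boolp classical_sets reals.
From mathcomp Require Import complex mpoly fraction perm ring zify.
Set Implicit Arguments.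
Unset Strict Implicit.
Unset Printing Implicit Defensive.
Import Order.TTheory GRing.Theory Num.Theory.
Local Open Scope ring_scope.
Local Open Scope classical_set_scope.

(** With y_m = t z_1m + z_nm one has s_t v_m = y_m e_1, so a minor of the i-th
    matrix is zero or some y_m p_B, and the i-th ideal is the product
    J_i K_(h(i)). Everything follows from the primality of J_l + K_j for l < j:
    it makes y_1, ..., y_j a regular sequence modulo K_j, hence the intersection
    of J_l and K_j equals J_l K_j for l <= j, and the modular law along the
    increasing chain J_(i-1) and the decreasing chain K_(h(i)) gives the
    intersection formula.

    Primality is proved by specializing the entries of one row of a generic
    matrix one at a time. Let Q_s be the ideal of maximal minors after s entries
    have been specialized, and d a minor, one size smaller, that avoids this
    row. Inverting d, one column can be eliminated, so the saturation of Q_s at d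
    is prime. If d is a nonzerodivisor modulo Q_(s+1) = Q_s + (y), then by graded
    Nakayama it is one modulo Q_s, so Q_s is prime. The induction starts from
    an ideal Y + u I_1 + I_2, where Y is generated by the specialized linear
    forms and I_2 <= I_1 are determinantal ideals of matrices already known to
    define primes: for the generic matrix the row is specialized to
    (0, ..., 0, u), and for J_l + K_j the last row is specialized to
    -t (z_11, ..., z_1j), with u = t. *)

(** * Ideals and nonzerodivisors *)

Section Ideals.
Variable A : comPzRingType.
Implicit Types (I J S : set A) (a b : A).

Lemma idealN I a : is_ideal I -> I a -> I (- a).
Proof. by move=> [_ _ IM] Ia; rewrite -mulN1r; exact: IM. Qed.

Lemma idealB I a b : is_ideal I -> I a -> I b -> I (a - b).
Proof. by move=> HI Ia Ib; have [_ ID _] := HI; apply: ID => //; exact: idealN. Qed.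

Lemma idealMr I a b : is_ideal I -> I a -> I (a * b).
Proof. by move=> [_ _ IM] Ia; rewrite mulrC; exact: IM. Qed.

Lemma ideal_sum I (T : Type) (r : seq T) (P : pred T) (F : T -> A) :
  is_ideal I -> (forall i, P i -> I (F i)) -> I (\sum_(i <- r | P i) F i).
Proof. by move=> [I0 ID _] IF; apply: big_ind. Qed.

Lemma sub_ideal_gen S : S `<=` ideal_gen S.
Proof. by move=> a Sa I [_]; apply. Qed.

Lemma ideal_gen_subset S I : is_ideal I -> S `<=` I -> ideal_gen S `<=` I.
Proof. by move=> HI SI a; apply; split. Qed.

Lemma ideal_addl I J : is_ideal J -> I `<=` ideal_add I J.
Proof. by move=> [J0 _ _] a Ia; exists a => //; exists 0 => //; rewrite addr0. Qed.

Lemma ideal_addr I J : is_ideal I -> J `<=` ideal_add I J.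
Proof. by move=> [I0 _ _] a Ja; exists 0 => //; exists a => //; rewrite add0r. Qed.

Lemma ideal_add_subset I J S :
  is_ideal S -> I `<=` S -> J `<=` S -> ideal_add I J `<=` S.
Proof. by move=> [_ SD _] IS JS _ [a Ia [b Jb <-]]; apply: SD; [exact: IS|exact: JS]. Qed.

Lemma ideal_colon I b : is_ideal I -> is_ideal [set a | I (b * a)].
Proof.
move=> [I0 ID IM]; split=> [|a c /= Ia Ic|c a /= Ia].
- by rewrite /= mulr0.
- by rewrite mulrDr; exact: ID.
- by rewrite mulrCA; exact: IM.
Qed.

Lemma ideal_preimage (B : comPzRingType) (f : {rmorphism A -> B}) (I : set B) :
  is_ideal I -> is_ideal (f @^-1` I).
Proof.
move=> [I0 ID IM]; split=> [|a b /= Ia Ib|c a /= Ia].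
- by rewrite /= rmorph0.
- by rewrite /= rmorphD; exact: ID.
- by rewrite /= rmorphM; exact: IM.
Qed.

Lemma prime_preimage (B : comPzRingType) (f : {rmorphism A -> B}) (I : set B) :
  is_prime I -> is_prime (f @^-1` I).
Proof.
move=> [HI I1 IM]; split; first exact: ideal_preimage.
- by rewrite /= rmorph1.
- by move=> a b /=; rewrite rmorphM; exact: IM.
Qed.

Lemma primeX I a k : is_prime I -> I (a ^+ k) -> I a.
Proof.
move=> [_ I1 IM]; elim: k => [|k IHk]; first by rewrite expr0.
by rewrite exprS => /IM [].
Qed.

Lemma sub_ideal_sat d I : I `<=` ideal_sat d I.
Proof. by move=> a Ia; exists 0%N; rewrite expr0 mul1r. Qed.

Lemma nzd_expr I d k a : (forall b, I (d * b) -> I b) -> I (d ^+ k * a) -> I a.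
Proof.
move=> dI; elim: k => [|k IHk]; first by rewrite expr0 mul1r.
by rewrite exprS -mulrA => /dI.
Qed.

Lemma ideal_sat_nzd d I : (forall b, I (d * b) -> I b) -> ideal_sat d I = I.
Proof.
move=> dI; apply/seteqP; split; last exact: sub_ideal_sat.
by move=> a [k]; exact: nzd_expr.
Qed.

(* If [k] retracts [A] modulo [Y] and maps [Q] into [t I1 + I2], then a
   nonzerodivisor modulo [I1] and modulo [(t) + I2] is one modulo [Q]: an
   element of both [I1] and [(t) + I2] lies in [t I1 + I2], as [I2 <= I1] and
   [t] is a nonzerodivisor modulo [I1]. *)
Lemma nzd_retract (Q I1 I2 : set A) (k : {rmorphism A -> A}) (t d : A) :
    is_ideal Q -> is_ideal I1 -> I2 `<=` I1 ->
    (forall f, Q (f - k f)) ->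
    (forall f, Q f -> exists2 a, I1 a & exists2 b, I2 b & k f = t * a + b) ->
    (forall a, I1 a -> Q (t * a)) -> I2 `<=` Q ->
    k d = d ->
    (forall f, I1 (d * f) -> I1 f) -> (forall f, I1 (t * f) -> I1 f) ->
    (forall f a b, I2 b -> d * f = t * a + b ->
       exists a', exists2 b', I2 b' & f = t * a' + b') ->
  forall f, Q (d * f) -> Q f.
Proof.
move=> HQ HI1 I21 kQ Qk tQ I2Q kd dI1 tI1 dI2 f Qdf.
have [Q0 QD QM] := HQ; have [_ I1D I1M] := HI1.
rewrite -(subrK (k f) f); apply: (QD); first exact: kQ.
have [a Ia [b Ib]] := Qk _ Qdf; rewrite rmorphM kd => Edf.
have I1f : I1 (k f).
  by apply: dI1; rewrite Edf; apply: (I1D); [exact: I1M|exact: I21].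
have [a' [b' Ib' Ef]] := dI2 _ _ _ Ib Edf.
rewrite Ef; apply: QD; last exact: I2Q.
apply: tQ; apply: tI1.
by rewrite -(addrK b' (t * a')) -Ef; apply: idealB => //; exact: I21.
Qed.

End Ideals.

(** * Graded Nakayama for nonzerodivisors *)

Section GradedNakayama.
Variables (A : comNzRingType) (tau : {rmorphism A -> {poly A}}).
Hypothesis tau1 : forall f, (tau f).[1] = f.

(** [tau] encodes a grading: the coefficient of ['X^d] in [tau f] is the component of [f] of degree
    [d], and [tau1] says that the components add up to [f]. *)
Definition graded_ideal (Q : set A) : Prop := forall f d, Q f -> Q (tau f)`_d.

Lemma graded_ideal_gen (S : set A) :
  (forall g, S g -> exists e, tau g = g%:P * 'X^e) -> graded_ideal (ideal_gen S).
Proof.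
move=> homS f d Sf; have [S0 SD SM] := ideal_gen_ideal S.
have HT : is_ideal [set f | forall d, ideal_gen S (tau f)`_d].
  split=> [c|a b Sa Sb c|c a Sa e].
  - by rewrite rmorph0 coef0.
  - by rewrite rmorphD coefD; exact: SD.
  - by rewrite rmorphM coefM; apply: ideal_sum => [|i _]; [exact: ideal_gen_ideal|exact: SM].
apply: (Sf [set f | forall d, ideal_gen S (tau f)`_d]) => //.
split=> // g Sg c /=; have [e ->] := homS g Sg.
by rewrite coefCM coefXn; exact: idealMr (ideal_gen_ideal S) (sub_ideal_gen Sg).
Qed.

Lemma graded_ideal_add (I J : set A) :
  graded_ideal I -> graded_ideal J -> graded_ideal (ideal_add I J).
Proof.
move=> gI gJ _ d [a Ia [b Jb <-]]; rewrite rmorphD coefD.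
by exists (tau a)`_d; [exact: gI|exists (tau b)`_d => //; exact: gJ].
Qed.

(** Let P be the saturation of [Q] at [d]. As [d] is a nonzerodivisor modulo Q + (y), P lies in Q +
    (y); as [y] is one modulo P, P = Q + y P. Since [y] has degree 1, induction on the degree puts
    every component of an element of P into [Q]. *)
Lemma nzd_descend (Q : set A) (d y : A) :
    is_ideal Q -> graded_ideal Q -> tau y = y%:P * 'X ->
    (forall f, (exists2 q, Q q & exists g, d * f = q + y * g) ->
       exists2 q, Q q & exists g, f = q + y * g) ->
    (forall f, ideal_sat d Q (y * f) -> ideal_sat d Q f) ->
  forall f, Q (d * f) -> Q f.
Proof.
move=> HQ gQ tauy dQy ysat f Qdf; have [Q0 QD QM] := HQ.
have HP := @ideal_sat_ideal _ d Q HQ.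
have split_sat g : ideal_sat d Q g ->
    exists2 q, Q q & exists2 g', ideal_sat d Q g' & g = q + y * g'.
  move=> Pg; have [k Qk] := Pg.
  have [|q Qq [g' Eg]] := @nzd_expr _
      [set f | exists2 q, Q q & exists g, f = q + y * g] d k g dQy.
    by exists (d ^+ k * g) => //; exists 0; rewrite mulr0 addr0.
  exists q => //; exists g' => //; apply: ysat.
  rewrite -(addKr q (y * g')) -Eg addrC; apply: idealB => //.
  exact: sub_ideal_sat.
have coefQ e g : ideal_sat d Q g -> Q (tau g)`_e.
  elim: e g => [|e IHe] g /split_sat [q Qq [g' Pg' ->]];
    rewrite rmorphD rmorphM tauy coefD -mulrA coefCM coefXM /=.
    by rewrite mulr0 addr0; exact: gQ.
  by apply: QD; [exact: gQ|apply: QM; exact: IHe].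
rewrite -[f]tau1 horner_coef; apply: ideal_sum => // e _.
by apply: idealMr => //; apply: coefQ; exists 1%N; rewrite expr1.
Qed.

End GradedNakayama.

(** * The polynomial ring and its substitutions *)

Section Evaluation.
Variables (R : realType) (n : nat).
Local Notation A := (Ctz R n).
Local Notation t := (tvar R n).
Local Notation z := (zvar R n).

Definition Ctz_const : {rmorphism R[i] -> A} := @mpolyC (n * n).+1 R[i].

Lemma Ctz_mulf_eq0 (a b : A) : a * b = 0 -> a = 0 \/ b = 0.
Proof.
move=> /(@eqP {mpoly R[i][(n * n).+1]}).
by rewrite mulf_eq0 => /orP[] /eqP; [left|right].
Qed.

Lemma Ctz_frac_exists :
  {L : fieldType & {iota : {rmorphism A -> L} | forall a, iota a = 0 -> a = 0}}.
Proof.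
exists {fraction {mpoly R[i][(n * n).+1]}}.
exists (@FracField.tofrac {mpoly R[i][(n * n).+1]}).
by move=> a /eqP; rewrite tofrac_eq0 => /eqP.
Qed.

Definition Ctz_fractions : fieldType := projT1 Ctz_frac_exists.

Definition Ctz_frac : {rmorphism A -> Ctz_fractions} := sval (projT2 Ctz_frac_exists).

Lemma Ctz_frac_eq0 (a : A) : Ctz_frac a = 0 -> a = 0.
Proof. exact: (svalP (projT2 Ctz_frac_exists)). Qed.

Lemma zvar_index_lt i j : (1 <= i <= n)%N -> (1 <= j <= n)%N ->
  (i.-1 * n + j < (n * n).+1)%N.
Proof. by nia. Qed.

Variables (L : comNzRingType) (g : {rmorphism R[i] -> L}).

Lemma Ctz_eval_exists (b : L) (x : nat -> nat -> L) :
  {phi : {rmorphism A -> L} |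
    [/\ forall c, phi (Ctz_const c) = g c, phi t = b
      & forall i j, (1 <= i <= n)%N -> (1 <= j <= n)%N -> phi (z i j) = x i j]}.
Proof.
(* The variable of index [k > 0] is [z i j], where [i - 1] and [j - 1] are the quotient and the
   remainder of [k - 1] by [n]. *)
exists (mmap g (fun k : 'I_(n * n).+1 =>
  if k == 0%N :> nat then b else x (k.-1 %/ n).+1 (k.-1 %% n).+1)).
split=> [c||i j Hi Hj]; first exact: mmapC.
  by rewrite /tvar /= mmapX mmap1U.
rewrite /zvar /= mmapX mmap1U inordK ?zvar_index_lt //.
have -> : (i.-1 * n + j == 0)%N = false by nia.
have -> : (i.-1 * n + j).-1 = (i.-1 * n + j.-1)%N by nia.
have n0 : (0 < n)%N by lia.
have jn : (j.-1 < n)%N by lia.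
by rewrite divnMDl // divn_small // modnMDl modn_small // addn0 !prednK //; lia.
Qed.

Definition Ctz_eval b x : {rmorphism A -> L} := sval (Ctz_eval_exists b x).

Lemma Ctz_evalC b x c : Ctz_eval b x (Ctz_const c) = g c.
Proof. by rewrite /Ctz_eval; case: (svalP (Ctz_eval_exists b x)). Qed.

Lemma Ctz_evalt b x : Ctz_eval b x t = b.
Proof. by rewrite /Ctz_eval; case: (svalP (Ctz_eval_exists b x)). Qed.

Lemma Ctz_evalz b x i j : (1 <= i <= n)%N -> (1 <= j <= n)%N ->
  Ctz_eval b x (z i j) = x i j.
Proof. by rewrite /Ctz_eval; case: (svalP (Ctz_eval_exists b x)) => _ _; apply. Qed.

End Evaluation.

Lemma Ctz_ind (R : realType) (n : nat) (P : Ctz R n -> Prop) :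
    (forall c, P (Ctz_const R n c)) -> P (tvar R n) ->
    (forall i j, (1 <= i <= n)%N -> (1 <= j <= n)%N -> P (zvar R n i j)) ->
    (forall f g, P f -> P g -> P (f + g)) ->
    (forall f g, P f -> P g -> P (f * g)) ->
  forall f, P f.
Proof.
move=> PC Pt Pz PD PM f.
have Pvar (k : 'I_(n * n).+1) : P 'X_k.
  have [k0|k0] := eqVneq (k : nat) 0%N.
    by have -> : k = ord0 by exact: val_inj.
  have kn := ltn_ord k.
  have n0 : (0 < n)%N by nia.
  have Ek := divn_eq k.-1 n; have Hm := ltn_pmod k.-1 n0.
  have Hd : (k.-1 %/ n < n)%N by rewrite ltn_divLR; lia.
  have := @Pz (k.-1 %/ n).+1 (k.-1 %% n).+1; rewrite /zvar /= addnS -Ek.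
  by rewrite prednK ?inord_val; [apply; lia|lia].
have P1 : P 1 by rewrite -[1](rmorph1 (Ctz_const R n)).
elim/mpolyind: f => [|c m p _ _ Pp].
  by rewrite -[0](rmorph0 (Ctz_const R n)).
apply: (PD) => //.
have -> : c *: 'X_[m] = (Ctz_const R n c) * 'X_[m] :> Ctz R n.
  by rewrite /Ctz_const /= mul_mpolyC.
apply: (PM) => //.
rewrite mpolyXE_id; elim/big_ind: _ => // k _.
by elim: (m k) => [|e IHe]; rewrite ?expr0 ?exprS //; apply: PM.
Qed.

Section Substitution.
Variables (R : realType) (n : nat).
Local Notation A := (Ctz R n).
Local Notation t := (tvar R n).
Local Notation z := (zvar R n).

(* A substitution [phi] with denominator [d]: modulo [Q], every [f] is, up to a
   power of [d], a polynomial [g] fixed by the substitution. *)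
Lemma substitution_clear (L : comNzRingType) (iota phi : {rmorphism A -> L})
    (Q : set A) (d : A) :
    is_ideal Q -> phi d = iota d ->
    (forall c, phi (Ctz_const R n c) = iota (Ctz_const R n c)) ->
    phi t = iota t ->
    (forall i j, (1 <= i <= n)%N -> (1 <= j <= n)%N ->
       exists k, exists2 g, phi g = iota g & Q (d ^+ k * z i j - g)) ->
  forall f, exists k, exists2 g, phi g = iota g & Q (d ^+ k * f - g).
Proof.
move=> HQ phid phiC phit phiz.
have [Q0 QD QM] := HQ.
have fixed f : phi f = iota f ->
    exists k, exists2 g, phi g = iota g & Q (d ^+ k * f - g).
  by exists 0%N, f => //; rewrite expr0 mul1r subrr.
elim/Ctz_ind => [c||i j Hi Hj|f g|f g]; try exact: fixed; try exact: phiz.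
- move=> [k [f' Ef Qf]] [l [g' Eg Qg]]; exists (k + l)%N.
  exists (d ^+ l * f' + d ^+ k * g').
    by rewrite !rmorphD !rmorphM !rmorphXn phid Ef Eg.
  have -> : d ^+ (k + l) * (f + g) - (d ^+ l * f' + d ^+ k * g') =
      d ^+ l * (d ^+ k * f - f') + d ^+ k * (d ^+ l * g - g').
    by rewrite exprD; ring.
  by apply: QD; exact: QM.
- move=> [k [f' Ef Qf]] [l [g' Eg Qg]]; exists (k + l)%N.
  exists (f' * g'); first by rewrite !rmorphM Ef Eg.
  have -> : d ^+ (k + l) * (f * g) - f' * g' =
      d ^+ l * g * (d ^+ k * f - f') + f' * (d ^+ l * g - g').
    by rewrite exprD; ring.
  by apply: QD; exact: QM.
Qed.

Lemma retract_sub (k : {rmorphism A -> A}) (Y : set A) :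
    is_ideal Y -> (forall c, k (Ctz_const R n c) = Ctz_const R n c) ->
    Y (t - k t) ->
    (forall i j, (1 <= i <= n)%N -> (1 <= j <= n)%N -> Y (z i j - k (z i j))) ->
  forall f, Y (f - k f).
Proof.
move=> HY kC kt kz; have [Y0 YD YM] := HY.
elim/Ctz_ind => [c||i j Hi Hj|f g Yf Yg|f g Yf Yg] //; first by rewrite kC subrr.
- exact: kz.
- have -> : f + g - k (f + g) = (f - k f) + (g - k g) by rewrite rmorphD; ring.
  exact: YD.
- have -> : f * g - k (f * g) = g * (f - k f) + k f * (g - k g).
    by rewrite rmorphM; ring.
  by apply: YD; exact: YM.
Qed.

(** The saturation is the kernel of [phi], a map to a domain. It lies in the kernel because [phi d]
    is nonzero; conversely [d ^+ k * f] is congruent modulo [Q] to some [g] with [phi g = iota g],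
    and [phi f = 0] forces [g = 0]. *)
Lemma sat_prime (L : idomainType) (iota phi : {rmorphism A -> L})
    (Q : set A) (d : A) :
    is_ideal Q -> (forall f, iota f = 0 -> f = 0) -> (forall f, Q f -> phi f = 0) ->
    phi d = iota d -> phi d != 0 ->
    (forall c, phi (Ctz_const R n c) = iota (Ctz_const R n c)) ->
    phi t = iota t ->
    (forall i j, (1 <= i <= n)%N -> (1 <= j <= n)%N ->
       exists k, exists2 g, phi g = iota g & Q (d ^+ k * z i j - g)) ->
  is_prime (ideal_sat d Q).
Proof.
move=> HQ iota0 phiQ phid phid0 phiC phit phiz.
have satE f : ideal_sat d Q f <-> phi f = 0.
  split=> [[k /phiQ/eqP]|phif].
    by rewrite rmorphM rmorphXn mulf_eq0 expf_eq0 (negbTE phid0) andbF => /eqP.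
  have [k [g phig Qg]] := substitution_clear HQ phid phiC phit phiz f.
  exists k; have g0 : g = 0.
    apply: iota0; rewrite -phig -[g](subKr (d ^+ k * f)) rmorphB.
    by rewrite (phiQ _ Qg) rmorphM phif mulr0 subr0.
  by rewrite -[_ * _]subr0 -[X in _ - X]g0.
split; first exact: ideal_sat_ideal.
  by move/satE/eqP; rewrite rmorph1 oner_eq0.
move=> a b /satE/eqP; rewrite rmorphM mulf_eq0 => /orP[] /eqP ?.
  by left; apply/satE.
by right; apply/satE.
Qed.

End Substitution.

(** * Determinantal ideals *)

Section Minors.
Variables (R : realType) (n : nat).
Local Notation A := (Ctz R n).
Local Notation t := (tvar R n).
Local Notation z := (zvar R n).

Definition zrows m (f : 'I_m -> nat) : 'M[A]_m :=
  \matrix_(a < m, b < m) z (f a) b.+1.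

(* Row sequences are arbitrary functions: repetitions and reorderings only add
   generators that are zero or equal up to sign. *)
Definition minor_ideal (rs : seq nat) m : set A :=
  ideal_gen [set \det (zrows f) | f in [set f : 'I_m -> nat | forall a, f a \in rs]].

Lemma minor_ideal_ideal rs m : is_ideal (minor_ideal rs m).
Proof. exact: ideal_gen_ideal. Qed.

Lemma minor_in_ideal rs m (f : 'I_m -> nat) :
  (forall a, f a \in rs) -> minor_ideal rs m (\det (zrows f)).
Proof. by move=> Hf; apply: sub_ideal_gen; exists f. Qed.

Lemma minor_ideal_subset rs m (I : set A) : is_ideal I ->
    (forall f : 'I_m -> nat, (forall a, f a \in rs) -> injective f ->
       I (\det (zrows f))) ->
  minor_ideal rs m `<=` I.
Proof.
move=> HI If; apply: ideal_gen_subset => // _ [f Hf <-].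
have [inj_f|] := boolP (injectiveb f); first by apply: If => //; exact/injectiveP.
move=> /injectivePn [a [b ab Eab]].
rewrite (determinant_alternate ab) => [|c]; first by have [] := HI.
by rewrite !mxE Eab.
Qed.

Lemma minor_idealS rs rs' m :
  {subset rs <= rs'} -> minor_ideal rs m `<=` minor_ideal rs' m.
Proof.
move=> sub; apply: minor_ideal_subset; first exact: minor_ideal_ideal.
by move=> f Hf _; apply: minor_in_ideal => a; exact: sub.
Qed.

Lemma minor_ideal_small rs m : (size rs < m)%N -> minor_ideal rs m = [set 0].
Proof.
move=> small; apply/seteqP; split=> [|_ ->]; last first.
  by have [] := minor_ideal_ideal rs m.
apply: minor_ideal_subset; first exact: ideal_zero_ideal.
move=> f Hf inj_f; suff : (m <= size rs)%N by rewrite leqNgt small.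
rewrite -[m]card_ord -(size_codom f); apply: uniq_leq_size.
  exact/injectiveP.
by move=> _ /codomP [a ->].
Qed.

Lemma minor_ideal_succ rs m : minor_ideal rs m.+1 `<=` minor_ideal rs m.
Proof.
apply: minor_ideal_subset; first exact: minor_ideal_ideal.
have HI := minor_ideal_ideal rs m; have [_ _ IM] := HI.
move=> f Hf _; rewrite (expand_det_col _ ord_max).
apply: ideal_sum => // a _; rewrite /cofactor; apply: (IM); apply: (IM).
rewrite (_ : row' _ _ = zrows (f \o lift a)); last first.
  by apply/matrixP => b c; rewrite !mxE /= /bump leqNgt ltn_ord.
by apply: minor_in_ideal => b; exact: Hf.
Qed.

(** Multiplying by the adjugate shows that every maximal minor kills a vector [u] annihilated by all
    rows, and [u k] is nonzero in a domain. *)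
Lemma minor_ideal_vanish (L : idomainType) (psi : {rmorphism A -> L}) rs m
    (u : 'I_m -> L) (k : 'I_m) :
    u k != 0 ->
    (forall r, r \in rs -> \sum_(l < m) psi (z r l.+1) * u l = 0) ->
  forall f, minor_ideal rs m f -> psi f = 0.
Proof.
move=> uk0 Hu; apply: minor_ideal_subset.
  exact: ideal_preimage (ideal_zero_ideal L).
move=> f Hf _; apply/eqP.
have : \adj (map_mx psi (zrows f)) *m (map_mx psi (zrows f) *m \col_l u l) = 0.
  rewrite (_ : map_mx psi (zrows f) *m _ = 0) ?mulmx0 //.
  apply/matrixP => a b; rewrite !mxE -[RHS](Hu (f a)) //.
  by apply: eq_bigr => l _; rewrite !mxE.
rewrite mulmxA mul_adj_mx mul_scalar_mx det_map_mx => /matrixP /(_ k 0).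
by rewrite !mxE => /eqP; rewrite mulf_eq0 (negbTE uk0) orbF.
Qed.

Lemma mem_iota2 k : (k \in iota 2 n.-1) = (2 <= k <= n)%N.
Proof. by rewrite mem_iota; lia. Qed.

(** Sorting the values of an injective [f] permutes the rows of the minor and changes at most its
    sign. *)
Lemma minor_ideal_K m : minor_ideal (iota 2 n.-1) m = K R n m.
Proof.
apply/seteqP; split; last first.
  apply: ideal_gen_subset; first exact: minor_ideal_ideal.
  move=> _ [B [_ HB HS] <-]; subst m; rewrite /pB.
  apply: (@minor_in_ideal _ _ (fun a : 'I_(size B) => nth 0%N B a)) => a.
  by rewrite mem_iota2; exact: HB (mem_nth 0%N (ltn_ord a)).
apply: minor_ideal_subset; first exact: (@ideal_gen_ideal A).
move=> f Hf inj_f; have [_ _ KM] : is_ideal (K R n m) by exact: ideal_gen_ideal.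
pose B := sort leq (codom f).
have szB : size B = m by rewrite size_sort size_codom card_ord.
have szBb : size B == m by rewrite szB.
have szf : size (codom f) == m by rewrite size_codom card_ord.
have /tuple_permP [s Es] : perm_eq (Tuple szf) (Tuple szBb).
  by rewrite perm_sym; exact/permPl/perm_sort.
have fE a : f a = nth 0%N B (s a).
  have /= <- : nth 0%N (Tuple szf) a = f a.
    by rewrite /= /codom /image_mem (nth_map a) ?size_enum_ord // nth_ord_enum.
  by rewrite /= Es -tnth_nth tnth_mktuple (tnth_nth 0%N).
have -> : zrows f = row_perm s (zrows (fun a : 'I_m => nth 0%N B a)).
  by apply/matrixP => a b; rewrite !mxE fE.
rewrite row_permE det_mulmx; apply: KM; apply: (@sub_ideal_gen A); exists B.
  split=> //; last 1 first.
    move=> k; rewrite mem_sort => /codomP [a ->].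
    by rewrite -mem_iota2.
  by rewrite ltn_sorted_uniq_leq sort_uniq sort_sorted ?andbT //; exact/injectiveP.
by rewrite /pB; clearbody B; subst m.
Qed.

Definition Ctz_poly_const : {rmorphism R[i] -> {poly A}} :=
  polyC \o Ctz_const R n.

(** [t] has degree 0 and every [z i j] has degree 1, so the forms [t z_1l + z_nl] are homogeneous of
    degree 1. *)
Definition Ctz_grading : {rmorphism A -> {poly A}} :=
  Ctz_eval n Ctz_poly_const t%:P (fun i j => (z i j)%:P * 'X).

Lemma Ctz_grading1 f : (Ctz_grading f).[1] = f.
Proof.
elim/Ctz_ind: f => [c||i j Hi Hj|f g Ef Eg|f g Ef Eg].
- by rewrite Ctz_evalC /= hornerC.
- by rewrite Ctz_evalt hornerC.
- by rewrite Ctz_evalz // !hornerE.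
- by rewrite (rmorphD (Ctz_grading)) hornerD Ef Eg.
- by rewrite (rmorphM Ctz_grading) hornerM Ef Eg.
Qed.

Lemma minor_ideal_graded rs m : (m <= n)%N ->
  {in rs, forall r, 1 <= r <= n}%N -> graded_ideal Ctz_grading (minor_ideal rs m).
Proof.
move=> mn Hrs; apply: graded_ideal_gen => _ [f Hf <-]; exists m.
rewrite -det_map_mx (_ : map_mx _ _ = 'X *: map_mx polyC (zrows f)); last first.
  apply/matrixP => a b; rewrite !mxE Ctz_evalz ?(mulrC 'X) //; first exact: Hrs.
  by have := ltn_ord b; lia.
by rewrite detZ det_map_mx mulrC.
Qed.

End Minors.
Arguments minor_ideal : clear implicits.

(** * Specializing one row *)

Section SpecialRow.
Variables (R : realType) (n p : nat).
Local Notation A := (Ctz R n).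
Local Notation t := (tvar R n).
Local Notation z := (zvar R n).

Definition row_cons (r : nat) (B : 'I_p -> nat) (a : 'I_p.+1) : nat :=
  if unlift ord0 a is Some a' then B a' else r.

(** These are the coefficients in the expansion of a minor along a row placed on top of the rows
    [B]. They form a vector annihilated by the rows [B], since a repeated row gives determinant
    zero. *)
Definition row_cofactor (B : 'I_p -> nat) (l : 'I_p.+1) : A :=
  (-1) ^+ l * \det (\matrix_(a < p, b < p) z (B a) (lift l b).+1).

Lemma det_row_cons r B :
  \det (zrows R n (row_cons r B)) = \sum_(l < p.+1) z r l.+1 * row_cofactor B l.
Proof.
rewrite (expand_det_row _ ord0); apply: eq_bigr => l _.
rewrite !mxE /row_cons unlift_none /cofactor add0n; congr (_ * (_ * \det _)).
by apply/matrixP => a b; rewrite !mxE liftK.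
Qed.

Lemma det_row_cons_repeat B a : \det (zrows R n (row_cons (B a) B)) = 0.
Proof.
apply: (@determinant_alternate _ _ _ ord0 (lift ord0 a)); first exact: neq_lift.
by move=> b; rewrite !mxE /row_cons unlift_none liftK.
Qed.

Definition linear_ideal (y : nat -> A) (s : nat) : set A :=
  ideal_gen [set y l | l in [set l | 1 <= l <= s]%N].

Lemma linear_in_ideal y s l : (1 <= l <= s)%N -> linear_ideal y s (y l).
Proof. by move=> Hl; apply: sub_ideal_gen; exists l. Qed.

Lemma linear_ideal_subset y s (I : set A) : is_ideal I ->
  (forall l, (1 <= l <= s)%N -> I (y l)) -> linear_ideal y s `<=` I.
Proof. by move=> HI Iy; apply: ideal_gen_subset => // _ [l Hl <-]; exact: Iy. Qed.

Variables (rs : seq nat) (rho : nat) (B : 'I_p -> nat) (k : 'I_p.+1).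
Variables (c y : nat -> A).
Hypothesis pn : (p < n)%N.
Hypothesis Hrs : {in rs, forall r, 1 <= r <= n}%N.
Hypothesis Hrho : rho \in rs.
Hypothesis HB : forall a, B a \in rs /\ B a != rho.
Hypothesis Hc : (forall l, c l = 0) \/ (1%N \notin rs /\ forall l, c l = - (t * z 1 l)).
Hypothesis yE : forall l, y l = z rho l - c l.

Local Notation u := (row_cofactor B).

(* The determinantal ideal after specializing the first [s] entries of the row
   [rho] to [c 1, ..., c s]. *)
Definition special_ideal s : set A :=
  ideal_add (linear_ideal y s) (minor_ideal R n rs p.+1).

Lemma special_ideal_ideal s : is_ideal (special_ideal s).
Proof. by apply: ideal_add_ideal; exact: ideal_gen_ideal. Qed.

Lemma special_ideal_y s l : (1 <= l <= s)%N -> special_ideal s (y l).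
Proof.
by move=> Hl; apply: ideal_addl; [exact: ideal_gen_ideal|exact: linear_in_ideal].
Qed.

Lemma special_ideal_minor s f : minor_ideal R n rs p.+1 f -> special_ideal s f.
Proof. by apply: ideal_addr; exact: ideal_gen_ideal. Qed.

Lemma special_idealS s f : special_ideal s.+1 f <->
  exists2 q, special_ideal s q & exists g, f = q + y s.+1 * g.
Proof.
have [J0 JD JM] := special_ideal_ideal s; split; last first.
  move=> [q Jq [g ->]]; have [_ JD' JM'] := special_ideal_ideal s.+1.
  apply: JD'; last first.
    by rewrite mulrC; apply: JM'; apply: special_ideal_y; rewrite ltnSn.
  case: Jq => a Ya [b Mb <-]; exists a; last by exists b.
  apply: linear_ideal_subset Ya => [|l Hl]; first exact: ideal_gen_ideal.
  by apply: linear_in_ideal; lia.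
have HS : is_ideal [set f | exists2 q, special_ideal s q & exists g, f = q + y s.+1 * g].
  split=> [|a b [q Jq [g ->]] [q' Jq' [g' ->]]|a b [q Jq [g ->]]].
  - by exists 0 => //; exists 0; rewrite mulr0 addr0.
  - by exists (q + q'); [exact: JD|exists (g + g'); ring].
  - by exists (a * q); [exact: JM|exists (a * g); ring].
move: f; apply: ideal_add_subset => //.
- apply: linear_ideal_subset => // l Hl.
  have [ls|->] : (l <= s)%N \/ l = s.+1 by lia.
    exists (y l); first by apply: special_ideal_y; lia.
    by exists 0; rewrite mulr0 addr0.
  by exists 0 => //; exists 1; rewrite mulr1 add0r.
- move=> f Mf; exists f; first exact: special_ideal_minor.
  by exists 0; rewrite mulr0 addr0.
Qed.

Section Elimination.
Variable s : nat.
Hypothesis sk : (s <= k)%N.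

Local Notation iota := (Ctz_frac R n).

Definition special_entry r l : A := if (r == rho) && (l <= s)%N then c l else z r l.

Definition eliminated r := (r \in rs) && (r \notin codom B).

(* Inverting [u k], a minor of the rows [B], lets the entry in column [k] of every
   other row be solved for: the row is a combination of the rows [B]. *)
Definition elim_entry r l :=
  if eliminated r && (l == k.+1) then
    - (\sum_(l' < p.+1 | l' != k) iota (special_entry r l'.+1) * iota (u l'))
      / iota (u k)
  else iota (special_entry r l).

Definition frac_const : {rmorphism R[i] -> Ctz_fractions R n} :=
  iota \o Ctz_const R n.

Definition elim_map : {rmorphism A -> Ctz_fractions R n} :=
  Ctz_eval n frac_const (iota t) elim_entry.

Let col_in (l : 'I_p.+1) : (1 <= l.+1 <= n)%N.
Proof. by have := ltn_ord l; lia. Qed.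

Let phiB a l : (1 <= l <= n)%N -> elim_map (z (B a) l) = iota (z (B a) l).
Proof.
move=> Hl; have [Ba Bar] := HB a; rewrite Ctz_evalz //; last exact: Hrs.
by rewrite /elim_entry /eliminated codom_f andbF /special_entry (negbTE Bar).
Qed.

Let phiu l : elim_map (u l) = iota (u l).
Proof.
rewrite /row_cofactor !rmorphM !rmorphXn !rmorphN !rmorph1; congr (_ * _).
by rewrite -!det_map_mx; congr (\det _); apply/matrixP => a b; rewrite !mxE phiB.
Qed.

(** In the second case of [Hc], row 1 lies outside [rs], so [z 1 l] is neither specialized nor
    eliminated. *)
Let phic l : (1 <= l <= n)%N -> elim_map (c l) = iota (c l).
Proof.
move=> Hl; have [->|[n1 ->]] := Hc.
  by rewrite (rmorph0 elim_map) (rmorph0 iota).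
rewrite (rmorphN elim_map) (rmorphN iota) (rmorphM elim_map) (rmorphM iota).
rewrite Ctz_evalt Ctz_evalz //; last by lia.
congr (- (_ * _)); rewrite /elim_entry /eliminated (negbTE n1) /special_entry.
by have [E|//] := eqVneq 1%N rho; rewrite E Hrho in n1.
Qed.

(** [sat_prime] applies to [elim_map]: the solved entries make every row of [rs] annihilate the
    cofactor vector, so all minors vanish. As [s <= k], the column [k.+1] solved for is not among
    the specialized ones. *)
Lemma special_sat_prime : u k != 0 -> is_prime (ideal_sat (u k) (special_ideal s)).
Proof.
move=> uk0; have iuk0 : iota (u k) != 0.
  by apply: contra_neq uk0; exact: Ctz_frac_eq0.
have HQ := special_ideal_ideal s; have [Q0 QD QM] := HQ.
apply: (@sat_prime _ _ _ iota elim_map) => //.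
- exact: Ctz_frac_eq0.
- apply: ideal_add_subset; first exact: ideal_preimage (ideal_zero_ideal _).
    apply: linear_ideal_subset; first exact: ideal_preimage (ideal_zero_ideal _).
    move=> l Hl /=; have ln : (1 <= l <= n)%N by have := ltn_ord k; lia.
    rewrite yE rmorphB phic // Ctz_evalz //; last exact: Hrs.
    rewrite /elim_entry /special_entry eqxx.
    have -> : (l == k.+1) = false by lia.
    have -> : (l <= s)%N by lia.
    by rewrite andbF subrr.
  apply: (@minor_ideal_vanish _ _ _ _ _ _ (iota \o u) k) => // r Hr.
  have [/codomP [a ->]|rB] := boolP (r \in codom B).
    have := congr1 iota (det_row_cons_repeat B a).
    rewrite det_row_cons rmorph_sum rmorph0 => E; rewrite -[RHS]E.
    by apply: eq_bigr => l _; rewrite rmorphM phiB //; exact: col_in.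
  rewrite (bigD1 k) //= Ctz_evalz; [|exact: Hrs|exact: col_in].
  rewrite {1}/elim_entry /eliminated Hr rB eqxx /= divfK // addrC; apply/eqP.
  rewrite subr_eq0; apply/eqP; apply: eq_bigr => l lk; rewrite Ctz_evalz //; last first.
    exact: Hrs.
  by rewrite /elim_entry eqSS (_ : (l == k :> nat) = false) ?andbF //; exact: negbTE.
- by rewrite phiu.
- by move=> f; rewrite Ctz_evalC.
- by rewrite Ctz_evalt.
move=> r l Hr Hl.
have phie l' : (1 <= l' <= n)%N -> ~~ (eliminated r && (l' == k.+1)) ->
    elim_map (special_entry r l') = iota (special_entry r l').
  move=> Hl' ne; rewrite {1}/special_entry; case: ifP => E.
    by rewrite phic // /special_entry E.
  by rewrite Ctz_evalz // /elim_entry (negbTE ne).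
have Qe l' : special_ideal s (z r l' - special_entry r l') \/ l' = 0%N.
  case: l' => [|l']; [by right|left]; rewrite /special_entry; case: ifP => [|_].
    by case/andP=> /eqP -> l's; rewrite -yE; apply: special_ideal_y; lia.
  by rewrite subrr.
have [/andP[/andP[rrs rB] /eqP ->]|ne] := boolP (eliminated r && (l == k.+1)).
  exists 1%N, (- \sum_(l' < p.+1 | l' != k) special_entry r l'.+1 * u l').
    rewrite !rmorphN !rmorph_sum; congr (- _); apply: eq_bigr => l' l'k.
    rewrite (rmorphM elim_map) (rmorphM iota) phiu phie // eqSS negb_and.
    by apply/orP; right; exact: l'k.
  rewrite expr1.
  (* Expanding the minor with row [r] above [B] expresses [u k * z r k.+1] by the other entries of
     that row, modulo the ideal. *)
  have -> : u k * z r k.+1 - - (\sum_(l' < p.+1 | l' != k) special_entry r l'.+1 * u l')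
    = \det (zrows R n (row_cons r B))
      - \sum_(l' < p.+1 | l' != k) (z r l'.+1 - special_entry r l'.+1) * u l'.
    rewrite det_row_cons [X in _ = X - _](bigD1 k) //= opprK (mulrC (u k)) -addrA.
    congr (_ + _).
    by rewrite -sumrB; apply: eq_bigr => l' _; ring.
  apply: idealB => //.
    apply: special_ideal_minor; apply: minor_in_ideal => a; rewrite /row_cons.
    by case: unliftP => [a' _|_] //; have [] := HB a'.
  by apply: ideal_sum => // l' _; apply: idealMr => //; case: (Qe l'.+1).
exists 0%N, (special_entry r l); first exact: phie.
by rewrite mul1r; case: (Qe l) => // l0; lia.
Qed.

End Elimination.

Hypothesis y_homogeneous :
  forall l, (1 <= l <= n)%N -> Ctz_grading R n (y l) = (y l)%:P * 'X.

Lemma special_ideal_graded s : (s <= n)%N -> graded_ideal (Ctz_grading R n) (special_ideal s).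
Proof.
move=> sn; apply: graded_ideal_add; last exact: minor_ideal_graded.
apply: graded_ideal_gen => _ [l Hl <-]; exists 1%N; apply: y_homogeneous.
by move: Hl => /= Hl; lia.
Qed.

(* Descending induction from [e]: if [u k] is a nonzerodivisor modulo
   [special_ideal s.+1], then it is one modulo [special_ideal s] by [nzd_descend],
   so that [special_ideal s] equals its saturation at [u k], which is prime. The
   points show that [y s.+1] is not in that saturation. *)
Lemma special_ideal_descend e : (e <= k.+1)%N ->
    (forall f, special_ideal e (u k * f) -> special_ideal e f) ->
    (forall s, (s < e)%N -> exists psi : {rmorphism A -> R[i]},
       [/\ forall f, special_ideal s f -> psi f = 0, psi (u k) != 0
         & psi (y s.+1) != 0]) ->
  forall s, (s < e)%N -> is_prime (special_ideal s).
Proof.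
move=> ek nzd_e pts.
have sat_y s : (s < e)%N -> ~ ideal_sat (u k) (special_ideal s) (y s.+1).
  move=> se [m Qm]; have [psi [psiQ psiu psiy]] := pts s se.
  have /eqP := psiQ _ Qm.
  by rewrite rmorphM rmorphXn mulf_eq0 expf_eq0 (negbTE psiu) andbF (negbTE psiy).
have sat_p s : (s < e)%N -> is_prime (ideal_sat (u k) (special_ideal s)).
  move=> se; apply: special_sat_prime; first by lia.
  have [psi [_ psiu _]] := pts s se; apply: contra_neq psiu => ->.
  by rewrite rmorph0.
have nzd m : (m <= e)%N ->
    forall f, special_ideal (e - m) (u k * f) -> special_ideal (e - m) f.
  elim: m => [_|m IHm me]; first by rewrite subn0.
  have es : (e - m = (e - m.+1).+1)%N by lia.
  have se : (e - m.+1 < e)%N by lia.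
  have kn := ltn_ord k.
  apply: (@nzd_descend _ (Ctz_grading R n) _ _ _ (y (e - m.+1).+1)).
  - exact: Ctz_grading1.
  - exact: special_ideal_ideal.
  - by apply: special_ideal_graded; lia.
  - by apply: y_homogeneous; lia.
  - move=> f Hf; apply/special_idealS; rewrite -es; apply: IHm; first by lia.
    by rewrite es; apply/special_idealS.
  - by move=> f; have [_ _ satM] := sat_p _ se => /satM [/(sat_y _ se)|].
move=> s se; have := sat_p _ se.
rewrite ideal_sat_nzd // -(subKn (ltnW se)).
by apply: nzd; lia.
Qed.

End SpecialRow.

(** * Minors under substitutions and at points *)

Section Expansion.
Variables (R : realType) (n : nat).
Local Notation A := (Ctz R n).
Local Notation t := (tvar R n).
Local Notation z := (zvar R n).

Lemma det_zrows_map m (kappa : {rmorphism A -> A}) (f : 'I_m -> nat) :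
  (forall a (b : 'I_m), kappa (z (f a) b.+1) = z (f a) b.+1) ->
  kappa (\det (zrows R n f)) = \det (zrows R n f).
Proof.
by move=> Hf; rewrite -det_map_mx; congr (\det _); apply/matrixP => a b; rewrite !mxE.
Qed.

Lemma cofactor_zrows_map m (kappa : {rmorphism A -> A}) (f f' : 'I_m -> nat) a0 l :
  (forall a, a != a0 -> f a = f' a) ->
  (forall a (b : 'I_m), a != a0 -> kappa (z (f a) b.+1) = z (f a) b.+1) ->
  kappa (cofactor (zrows R n f) a0 l) = cofactor (zrows R n f') a0 l.
Proof.
move=> ff' Hf; rewrite -cofactor_map_mx /cofactor; congr (_ * \det _).
apply/matrixP => a b; have na : lift a0 a != a0 by rewrite eq_sym neq_lift.
by rewrite !mxE Hf // ff'.
Qed.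

Lemma minor_ideal_map m rs (kappa : {rmorphism A -> A}) :
    (forall r l, r \in rs -> (1 <= l <= m)%N -> kappa (z r l) = z r l) ->
  forall f, minor_ideal R n rs m f -> minor_ideal R n rs m (kappa f).
Proof.
move=> Hk; apply: minor_ideal_subset.
  by apply: ideal_preimage; exact: minor_ideal_ideal.
move=> f Hf _ /=; rewrite det_zrows_map; first exact: minor_in_ideal.
by move=> a b; rewrite Hk // ltn_ord.
Qed.

Lemma row_cofactor_map p (B : 'I_p -> nat) (k : 'I_p.+1) (kappa : {rmorphism A -> A}) :
  (forall a (l : 'I_p.+1), kappa (z (B a) l.+1) = z (B a) l.+1) ->
  kappa (row_cofactor R n B k) = row_cofactor R n B k.
Proof.
move=> HB; rewrite /row_cofactor rmorphM rmorphXn rmorphN rmorph1 -det_map_mx.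
by congr (_ * \det _); apply/matrixP => a b; rewrite !mxE HB.
Qed.

Lemma row_cofactor_point p (B : 'I_p -> nat) (k : 'I_p.+1) (psi : {rmorphism A -> R[i]}) :
  (forall a b : 'I_p, psi (z (B a) (lift k b).+1) = (a == b)%:R) ->
  psi (row_cofactor R n B k) != 0.
Proof.
move=> HB; rewrite /row_cofactor rmorphM rmorphXn rmorphN rmorph1 -det_map_mx.
rewrite (_ : map_mx _ _ = 1%:M); first by rewrite det1 mulr1 signr_eq0.
by apply/matrixP => a b; rewrite !mxE HB.
Qed.

(* The hypothesis on [d f] required by [nzd_retract]: modulo [t], the ring is
   retracted by [kappa] and [d] remains a nonzerodivisor modulo [I2]. *)
Lemma nzd_mod (I2 : set A) (kappa : {rmorphism A -> A}) (t0 d : A) :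
    (forall f, exists g, f - kappa f = t0 * g) -> kappa t0 = 0 -> kappa d = d ->
    (forall f, I2 f -> I2 (kappa f)) -> (forall f, I2 (d * f) -> I2 f) ->
  forall f a b, I2 b -> d * f = t0 * a + b ->
    exists a', exists2 b', I2 b' & f = t0 * a' + b'.
Proof.
move=> kf kt kd kI dI f a b Ib E; have [g Eg] := kf f.
exists g; exists (kappa f); last by rewrite -Eg subrK.
have := congr1 kappa E; rewrite rmorphD !rmorphM kt mul0r add0r kd => Ed.
by apply: dI; rewrite Ed; exact: kI.
Qed.

Lemma twisted_ideal (t0 : A) (I1 I2 : set A) : is_ideal I1 -> is_ideal I2 ->
  is_ideal [set f | exists2 a, I1 a & exists2 b, I2 b & f = t0 * a + b].
Proof.
move=> [I10 I1D I1M] [I20 I2D I2M].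
split=> [|_ _ [a Ia [b Ib ->]] [a' Ia' [b' Ib' ->]]|c _ [a Ia [b Ib ->]]].
- by exists 0 => //; exists 0; rewrite ?mulr0 ?addr0.
- by exists (a + a'); [exact: I1D|exists (b + b'); [exact: I2D|ring]].
- by exists (c * a); [exact: I1M|exists (c * b); [exact: I2M|ring]].
Qed.

Lemma multiples_ideal (t0 : A) : is_ideal [set f | exists g, f = t0 * g].
Proof.
split=> [|_ _ [a ->] [b ->]|c _ [a ->]]; first by exists 0; rewrite mulr0.
  by exists (a + b); rewrite mulrDr.
by exists (c * a); rewrite mulrCA.
Qed.

Lemma prime0 : is_prime [set 0 : A].
Proof.
split; first exact: ideal_zero_ideal.
  by move=> /eqP; rewrite oner_eq0.
exact: Ctz_mulf_eq0.
Qed.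

Lemma prime_nzd (P : set A) d : is_prime P -> ~ P d -> forall f, P (d * f) -> P f.
Proof. by move=> [_ _ PM] nPd f /PM []. Qed.

Definition coord_map (b : A) (x : nat -> nat -> A) : {rmorphism A -> A} :=
  Ctz_eval n (Ctz_const R n) b x.

Definition point (b : R[i]) (x : nat -> nat -> R[i]) : {rmorphism A -> R[i]} :=
  Ctz_eval n idfun b x.

Lemma coord_map_sub b x (Y : set A) :
    is_ideal Y -> Y (t - b) ->
    (forall i j, (1 <= i <= n)%N -> (1 <= j <= n)%N -> Y (z i j - x i j)) ->
  forall f, Y (f - coord_map b x f).
Proof.
move=> HY Yt Yz; apply: retract_sub => //.
- by move=> c; rewrite Ctz_evalC.
- by rewrite Ctz_evalt.
- by move=> i j Hi Hj; rewrite Ctz_evalz //; exact: Yz.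
Qed.

Lemma zvar_homogeneous i j : (1 <= i <= n)%N -> (1 <= j <= n)%N ->
  Ctz_grading R n (z i j) = (z i j)%:P * 'X.
Proof. by move=> Hi Hj; rewrite Ctz_evalz. Qed.

End Expansion.

Arguments point : clear implicits.

Lemma special_ideal0 (R : realType) (n p : nat) rs (y : nat -> Ctz R n) :
  special_ideal p rs y 0 = minor_ideal R n rs p.+1.
Proof.
apply/seteqP; split; last by move=> f; exact: special_ideal_minor.
apply: ideal_add_subset => //; first exact: minor_ideal_ideal.
apply: linear_ideal_subset; first exact: minor_ideal_ideal.
by move=> l; lia.
Qed.

(** * Primality of the maximal minors of a generic matrix *)

Section GenericMinors.
Variables (R : realType) (n : nat).
Local Notation A := (Ctz R n).
Local Notation t := (tvar R n).
Local Notation z := (zvar R n).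

(** The ideal is generated by variables, hence is the kernel of the substitution sending them to
    0. *)
Lemma minor_ideal1_prime rs : {in rs, forall r, 1 <= r <= n}%N -> (0 < n)%N ->
  is_prime (minor_ideal R n rs 1).
Proof.
move=> Hrs n0.
pose kappa := coord_map t (fun r l => if (r \in rs) && (l == 1%N) then 0 else z r l).
suff -> : minor_ideal R n rs 1 = kappa @^-1` [set 0].
  by apply: prime_preimage; exact: prime0.
apply/seteqP; split.
  apply: minor_ideal_subset; first exact: ideal_preimage (ideal_zero_ideal _).
  move=> f Hf _ /=; rewrite det_mx11 mxE Ctz_evalz ?Hf //; exact: Hrs.
have HI := minor_ideal_ideal R n rs 1; have [I0 _ _] := HI.
move=> f /= kf; rewrite -[f]subr0 -kf; apply: coord_map_sub => // [|i j _ _].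
  by rewrite subrr.
case: ifP => [/andP[irs /eqP ->]|_]; last by rewrite subrr.
have -> : z i 1 - 0 = \det (zrows R n (fun _ : 'I_1 => i)).
  by rewrite det_mx11 mxE subr0.
by apply: minor_in_ideal => _.
Qed.

Section Step.
Variables (rho : nat) (rs : seq nat) (p : nat).
Hypothesis Hrs : {in rho :: rs, forall r, 1 <= r <= n}%N.
Hypothesis uniq_rs : uniq (rho :: rs).
Hypothesis p0 : (0 < p)%N.
Hypothesis pn : (p < n)%N.
Hypothesis prs : (p <= size rs)%N.
Hypothesis prime_p : is_prime (minor_ideal R n rs p).
Hypothesis prime_p1 : is_prime (minor_ideal R n rs p.+1).

Let B (a : 'I_p) := nth 0%N rs a.

Let Bin a : B a \in rs.
Proof. by apply: mem_nth; apply: leq_trans (ltn_ord a) prs. Qed.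

Let index_B a : index (B a) rs = a.
Proof.
case/andP: uniq_rs => _ uniq_rs'.
by rewrite index_uniq //; apply: leq_trans (ltn_ord a) prs.
Qed.

Let Bneq r : r \in rs -> (r == rho) = false.
Proof. by case/andP: uniq_rs => nrs _ Hr; apply: contraNF nrs => /eqP <-. Qed.

(** In 1-based numbering [delta] omits column [p]. Omitting the last column would make [delta] a
    generator of [I1], which must not contain it. *)
Let k : 'I_p.+1 := inord p.-1.

Let kE : k = p.-1 :> nat.
Proof. by rewrite /k inordK; lia. Qed.

Let kB (b : 'I_p) : (lift k b).+1 = (if b.+1 == p then p.+1 else b.+1) :> nat.
Proof. by have := ltn_ord b; rewrite /= /bump kE; case: eqP; lia. Qed.

Local Notation delta := (row_cofactor R n B k).
Local Notation I1 := (minor_ideal R n rs p).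
Local Notation I2 := (minor_ideal R n rs p.+1).
Local Notation Q := (special_ideal p (rho :: rs) (z rho)).

Let Hrho : (1 <= rho <= n)%N.
Proof. by apply: Hrs; rewrite inE eqxx. Qed.

Let Hrs' r : r \in rs -> (1 <= r <= n)%N.
Proof. by move=> Hr; apply: Hrs; rewrite inE Hr orbT. Qed.

Let minor_rs m (f : 'I_m -> nat) : (forall a, f a \in rho :: rs) ->
  (forall a, f a != rho) -> forall a, f a \in rs.
Proof. by move=> Hf Hn a; have := Hf a; rewrite inE (negbTE (Hn a)). Qed.

Let delta_notin : ~ I1 delta.
Proof.
(* Column [p] vanishes on all rows of [rs], so [I1] vanishes here, while the rows [B] restricted to
   the columns of [delta] form the identity. *)
pose psi := point R n 0 (fun r l => (l == if (index r rs).+1 == p then p.+1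
                                  else (index r rs).+1)%:R).
have psid : psi delta != 0.
  apply: row_cofactor_point => a b; have ln := ltn_ord (lift k b).
  rewrite Ctz_evalz; [|exact: Hrs'|lia].
  rewrite index_B kB; congr (nat_of_bool _)%:R; rewrite -[a == b]val_eqE /=.
  by have := ltn_ord a; have := ltn_ord b; do 2 case: ifP; lia.
have kp : (k < p)%N by rewrite kE; lia.
move=> /(@minor_ideal_vanish _ _ _ psi _ _ (fun l => (l == Ordinal kp)%:R) (Ordinal kp)).
rewrite eqxx oner_eq0 => E; move/eqP: psid; apply; apply: E => // r Hr.
rewrite big1 // => l _; have [->|_] := eqVneq l (Ordinal kp); last by rewrite mulr0.
rewrite Ctz_evalz /=; [|exact: Hrs'|lia].
rewrite kE (_ : _ == _ = false) ?mul0r //.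
by case: ifP; lia.
Qed.

(** Setting the first [p] entries of row [rho] to 0 turns a minor through that row into [z rho p.+1]
    times a minor of size [p], up to sign. So modulo the linear forms the ideal is u I1 + I2 with u
    = [z rho p.+1], and [nzd_retract] applies. *)
Let special_nzd f : Q p (delta * f) -> Q p f.
Proof.
pose kappa := coord_map t (fun r l => if (r == rho) && (l <= p)%N then 0 else z r l).
have HQ : is_ideal (Q p) by exact: special_ideal_ideal.
have [Q0 QD QM] := HQ.
have kz r l : (1 <= r <= n)%N -> (1 <= l <= n)%N -> r != rho -> kappa (z r l) = z r l.
  by move=> Hr Hl rr; rewrite Ctz_evalz // (negbTE rr).
have krs r (l : nat) : r \in rs -> (1 <= l <= p.+1)%N -> kappa (z r l) = z r l.
  by move=> Hr Hl; apply: kz; [exact: Hrs'|lia|rewrite Bneq].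
have HW := twisted_ideal (z rho p.+1) (minor_ideal_ideal R n rs p)
  (minor_ideal_ideal R n rs p.+1).
have Hmin (g : 'I_p -> nat) : (forall a, g a \in rs) ->
    Q p (z rho p.+1 * \det (zrows R n g)).
  move=> Hg; have := det_row_cons R n rho g; rewrite (bigD1 ord_max) //= => Dg.
  have -> : z rho p.+1 * \det (zrows R n g) = (-1) ^+ p *
    (\det (zrows R n (row_cons rho g)) -
      \sum_(l < p.+1 | l != ord_max) z rho l.+1 * row_cofactor R n g l).
    rewrite Dg addrK /row_cofactor /= mulrCA; congr (_ * _).
    rewrite mulrA -exprMn mulrNN mulr1 expr1n mul1r; congr (\det _).
    by apply/matrixP => a b; rewrite !mxE /= /bump leqNgt ltn_ord.
  apply: QM; apply: idealB => //.
    apply: special_ideal_minor; apply: minor_in_ideal => a; rewrite /row_cons inE.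
    by case: unliftP => [a' _|_]; rewrite ?Hg ?orbT ?eqxx.
  apply: ideal_sum => // l; rewrite -val_eqE /= => lp; apply: idealMr => //.
  by apply: special_ideal_y; have := ltn_ord l; lia.
apply: (@nzd_retract _ _ I1 I2 kappa (z rho p.+1)) => //.
- exact: minor_ideal_ideal.
- exact: minor_ideal_succ.
- apply: coord_map_sub => // [|r l Hr Hl]; first by rewrite subrr.
  case: ifP => [/andP[/eqP -> lp]|_]; last by rewrite subrr.
  by rewrite subr0; apply: special_ideal_y; lia.
- apply: ideal_add_subset; first exact: (ideal_preimage kappa HW).
    apply: linear_ideal_subset; first exact: (ideal_preimage kappa HW).
    move=> l Hl /=; have [W0 _ _] := HW.
    by rewrite Ctz_evalz ?eqxx /=; [have -> : (l <= p)%N by lia|exact: Hrho|lia].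
  apply: minor_ideal_subset; first exact: (ideal_preimage kappa HW).
  move=> f' Hf inj_f /=; have [/existsP[a0 /eqP fa0]|] := boolP [exists a, f' a == rho].
    have fne a : a != a0 -> f' a \in rs.
      move=> aa0; have := Hf a; rewrite inE => /orP[/eqP E|//].
      by move/eqP: aa0; case; apply: inj_f; rewrite fa0.
    have -> : kappa (\det (zrows R n f')) = z rho p.+1 * cofactor (zrows R n f') a0 ord_max.
      rewrite (expand_det_row _ a0) rmorph_sum (bigD1 ord_max) //= big1 ?addr0.
        rewrite rmorphM mxE fa0 Ctz_evalz // eqxx ltnn /=.
        congr (_ * _); apply: cofactor_zrows_map => // a b aa0.
        by apply: krs; [exact: fne|have := ltn_ord b; lia].
      move=> l; rewrite -val_eqE /= => lp; have lo := ltn_ord l.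
      rewrite rmorphM mxE fa0 Ctz_evalz //; last by lia.
      by rewrite eqxx (_ : (l.+1 <= p)%N) ?mul0r //; lia.
    exists (cofactor (zrows R n f') a0 ord_max); last first.
      by exists 0; [have [] := minor_ideal_ideal R n rs p.+1|rewrite addr0].
    have [_ _ IM] := minor_ideal_ideal R n rs p; apply: IM.
    rewrite (_ : row' _ _ = zrows R n (f' \o lift a0)); last first.
      by apply/matrixP => a b; rewrite !mxE /= /bump leqNgt ltn_ord.
    by apply: minor_in_ideal => a; apply: fne; rewrite eq_sym neq_lift.
  move=> /existsPn fn; exists 0; first by have [] := minor_ideal_ideal R n rs p.
  exists (\det (zrows R n f')); first by apply: minor_in_ideal; exact: minor_rs.
  rewrite mulr0 add0r; apply: det_zrows_map => a b; apply: krs.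
    exact: minor_rs.
  by have := ltn_ord b; lia.
- have := ideal_colon (z rho p.+1) HQ => HC.
  by apply: minor_ideal_subset => // g Hg _; exact: Hmin.
- move=> f' If'; apply: special_ideal_minor; apply: minor_idealS If' => r Hr.
  by rewrite inE Hr orbT.
- by apply: row_cofactor_map => a l; apply: krs => //; have := ltn_ord l; lia.
- exact: prime_nzd.
- apply: prime_nzd => //.
  pose psi := point R n 0 (fun r l => ((r == rho) && (l == p.+1))%:R).
  move=> /(@minor_ideal_vanish _ _ _ psi _ _ (fun=> 1) (Ordinal p0)) E.
  have /eqP : psi (z rho p.+1) = 0.
    apply: E => [|r Hr]; first exact: oner_neq0.
    rewrite big1 // => l _; rewrite Ctz_evalz; [|exact: Hrs'|have := ltn_ord l; lia].
    by rewrite Bneq // mul0r.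
  by rewrite Ctz_evalz // ?eqxx ?oner_eq0 //; lia.
pose kappa0 := coord_map t (fun r l => if (r == rho) && (l == p.+1) then 0 else z r l).
have k0rs r (l : nat) : r \in rs -> (1 <= l <= p.+1)%N -> kappa0 (z r l) = z r l.
  by move=> Hr Hl; rewrite Ctz_evalz ?Bneq //; [exact: Hrs'|lia].
apply: (@nzd_mod _ _ _ kappa0).
- apply: (@coord_map_sub _ _ _ _ [set f | exists g, f = z rho p.+1 * g]).
  + exact: multiples_ideal.
  + by exists 0; rewrite subrr mulr0.
  + move=> r l _ _; case: ifP => [/andP[/eqP -> /eqP ->]|_].
      by exists 1; rewrite subr0 mulr1.
    by exists 0; rewrite subrr mulr0.
- by rewrite Ctz_evalz ?eqxx //; lia.
- by apply: row_cofactor_map => a l; apply: k0rs => //; have := ltn_ord l; lia.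
- exact: minor_ideal_map.
- by apply: prime_nzd => // /minor_ideal_succ.
Qed.

Lemma minor_ideal_step : is_prime (minor_ideal R n (rho :: rs) p.+1).
Proof.
rewrite -(special_ideal0 _ _ (z rho)).
apply: (@special_ideal_descend _ _ _ _ rho B k (fun=> 0) _ _ _ _ _ _ _ _ p) => //.
- by rewrite inE eqxx.
- by move=> a; rewrite inE Bin orbT Bneq.
- by left.
- by move=> l; rewrite subr0.
- by move=> l Hl; apply: zvar_homogeneous.
- by rewrite kE; lia.
move=> s sp.
(* Columns [p] and [p.+1] agree, so the difference of two basis vectors is annihilated by all rows.
   Row [rho] repeats the row of index [s] in [rs], which makes [z rho s.+1] the first entry of its
   row not to vanish. *)
pose x (r l : nat) : R[i] := let a := if r == rho then s else index r rs in
  ((a < p)%N && ((l == a.+1) || ((a.+1 == p) && (l == p.+1))))%:R.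
exists (point R n 0 x); split; last 2 first.
- apply: row_cofactor_point => a b; have ln := ltn_ord (lift k b).
  rewrite Ctz_evalz; [|exact: Hrs'|lia].
  rewrite /x Bneq // index_B kB ltn_ord /=; congr (nat_of_bool _)%:R; rewrite -[a == b]val_eqE /=.
  by have := ltn_ord a; have := ltn_ord b; case: ifP; lia.
- by rewrite Ctz_evalz //; [rewrite /x eqxx sp eqxx oner_eq0|lia].
apply: ideal_add_subset; first exact: ideal_preimage (ideal_zero_ideal _).
  apply: linear_ideal_subset; first exact: ideal_preimage (ideal_zero_ideal _).
  move=> l Hl /=; rewrite Ctz_evalz //; last by lia.
  by rewrite /x eqxx (_ : _ && _ = false) //; lia.
apply: (@minor_ideal_vanish _ _ _ _ _ _
  (fun l => (l == k)%:R - (l == ord_max)%:R) k).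
  have kmax : (k == ord_max) = false by rewrite -val_eqE /= kE; lia.
  by rewrite eqxx kmax subr0 oner_neq0.
move=> r Hr; under eq_bigr do rewrite mulrBr.
rewrite sumrB (bigD1 k) //= eqxx mulr1 big1 ?addr0; last first.
  by move=> l /negbTE ->; rewrite mulr0.
rewrite (bigD1 ord_max) //= eqxx mulr1 big1 ?addr0; last first.
  by move=> l /negbTE ->; rewrite mulr0.
rewrite !Ctz_evalz; try exact: Hrs; try by rewrite ?kE; lia.
apply/eqP; rewrite subr_eq0 /x kE; apply/eqP; congr (nat_of_bool _)%:R.
by case: ifP => _; lia.
Qed.

End Step.

(** Induction on the rows for all sizes at once, since [minor_ideal_step] uses the minors of sizes
    [p] and [p.+1] of the remaining rows. *)
Lemma minor_ideal_prime rs m : {in rs, forall r, 1 <= r <= n}%N -> uniq rs ->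
  (1 <= m <= n)%N -> is_prime (minor_ideal R n rs m).
Proof.
elim: rs m => [|rho rs IHrs] m Hrs uniq_rs Hm.
  by rewrite minor_ideal_small //=; [exact: prime0|lia].
have [small|big] := ltnP (size (rho :: rs)) m.
  by rewrite minor_ideal_small //; exact: prime0.
case: m Hm big => [//|[|p]] Hm big; first by apply: minor_ideal1_prime => //; lia.
have Hrs' : {in rs, forall r, 1 <= r <= n}%N.
  by move=> r Hr; apply: Hrs; rewrite inE Hr orbT.
have uniq_rs' : uniq rs by case/andP: uniq_rs.
by apply: minor_ideal_step => //; apply: IHrs => //; lia.
Qed.

End GenericMinors.

(** * The ideals J_l + K_j *)

Section TwistedMinors.
Variables (R : realType) (n : nat).
Local Notation A := (Ctz R n).
Local Notation t := (tvar R n).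
Local Notation z := (zvar R n).

Definition yform (l : nat) : A := t * z 1 l + z n l.

Lemma yform_homogeneous l : (0 < n)%N -> (1 <= l <= n)%N ->
  Ctz_grading R n (yform l) = (yform l)%:P * 'X.
Proof.
move=> n0 Hl; rewrite /yform (rmorphD (Ctz_grading R n)) (rmorphM (Ctz_grading R n)).
rewrite Ctz_evalt !zvar_homogeneous //; try by lia.
by rewrite polyCD polyCM mulrDl mulrA.
Qed.

Section Rank.
Variable p : nat.
Hypothesis pn : (p.+1 < n)%N.

(** The ideals treated are J_s + K_j with j = [p.+1]. The rows of [delta] are 2, ..., p + 1 and
    avoid both row 1 and, as [p.+1 < n], row [n]; its columns are 1, ..., p. *)
Let B (a : 'I_p) := a.+2.

Local Notation delta := (row_cofactor R n B ord_max).
Local Notation I1 := (minor_ideal R n (iota 1 n.-1) p.+1).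
Local Notation I2 := (minor_ideal R n (iota 2 n.-2) p.+1).
Local Notation Q := (special_ideal p (iota 2 n.-1) yform).

Let mem1 r : (r \in iota 1 n.-1) = (1 <= r < n)%N.
Proof. by rewrite mem_iota; lia. Qed.

Let mem12 r : (r \in iota 2 n.-2) = (2 <= r < n)%N.
Proof. by rewrite mem_iota; lia. Qed.

Let Q_ideal s : is_ideal (Q s).
Proof. exact: special_ideal_ideal. Qed.

Let sub12 : I2 `<=` I1.
Proof. by apply: minor_idealS => r; rewrite mem12 mem1; lia. Qed.

(** Rows 2, ..., p + 1 are the first [p] basis vectors and the other rows vanish: [delta] is nonzero
    there and column [p.+1] is zero. *)
Let basis_row (r l : nat) : R[i] := ((2 <= r < p.+2)%N && (l.+1 == r))%:R.

Let delta_point b x : (forall r l, (1 < r)%N -> x r l = basis_row r l) ->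
  point R n b x delta != 0.
Proof.
move=> Hx; apply: row_cofactor_point => a b'.
have ap := ltn_ord a; have b'p := ltn_ord b'; rewrite Ctz_evalz; try by rewrite ?/B /= /bump; lia.
rewrite Hx // /basis_row /B; congr (nat_of_bool _)%:R.
by rewrite -[a == b']val_eqE /= /bump; lia.
Qed.

Let basis_row_sum (rs : seq nat) b x : {in rs, forall r, 1 <= r <= n}%N ->
    (forall r, r \in rs -> x r p.+1 = 0) ->
  forall f, minor_ideal R n rs p.+1 f -> point R n b x f = 0.
Proof.
move=> Hrs Hx; apply: (@minor_ideal_vanish _ _ _ _ _ _ (fun l => (l == ord_max)%:R) ord_max).
  by rewrite eqxx oner_neq0.
move=> r Hr; rewrite big1 // => l _.
have [->|_] := eqVneq l ord_max; last by rewrite mulr0.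
by rewrite Ctz_evalz /= ?Hx ?mul0r //; [exact: Hrs|lia].
Qed.

Let delta_notin : ~ I1 delta.
Proof.
move=> /(@basis_row_sum _ 0 basis_row) E.
have /eqP := @delta_point 0 basis_row (fun _ _ _ => erefl); apply; apply: E => r.
  by rewrite mem1; lia.
by rewrite /basis_row => _; rewrite (_ : _ && _ = false) //; lia.
Qed.

Let t_notin : ~ I1 t.
Proof.
move=> /(@basis_row_sum _ 1 (fun _ _ => 0)) E.
have /eqP : point R n 1 (fun _ _ => 0) t = 0 by apply: E => // r; rewrite mem1; lia.
by rewrite Ctz_evalt oner_eq0.
Qed.

Let iota_in a m : (0 < a)%N -> (a + m <= n.+1)%N ->
  {in iota a m, forall r, 1 <= r <= n}%N.
Proof. by move=> a0 am r; rewrite mem_iota; lia. Qed.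

Let prime_I1 : is_prime I1.
Proof.
apply: minor_ideal_prime; [|exact: iota_uniq|lia].
by apply: iota_in; lia.
Qed.

Let prime_I2 : is_prime I2.
Proof.
apply: minor_ideal_prime; [|exact: iota_uniq|lia].
by apply: iota_in; lia.
Qed.

(** Sending [z n l] to [- (t * z 1 l)] turns a minor through row [n] into [- t] times the minor with
    row 1 in its place. So modulo the linear forms the ideal is t I1 + I2. *)
Let special_nzd f : Q p.+1 (delta * f) -> Q p.+1 f.
Proof.
pose kappa := coord_map t (fun r l => if (r == n) && (l <= p.+1)%N then - (t * z 1 l)
                                      else z r l).
have [Q0 QD QM] := Q_ideal p.+1.
have kz r l : (1 <= r < n)%N -> (1 <= l <= p.+1)%N -> kappa (z r l) = z r l.
  move=> Hr Hl; rewrite Ctz_evalz; try by lia.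
  by rewrite (_ : r == n = false) //; lia.
have kn l : (1 <= l <= p.+1)%N -> kappa (z n l) = - (t * z 1 l).
  move=> Hl; rewrite Ctz_evalz; try by lia.
  by rewrite eqxx (_ : (l <= p.+1)%N) //; lia.
have kt : kappa t = t by rewrite Ctz_evalt.
have HW := twisted_ideal t (minor_ideal_ideal R n (iota 1 n.-1) p.+1)
  (minor_ideal_ideal R n (iota 2 n.-2) p.+1).
have [_ _ I1M] := minor_ideal_ideal R n (iota 1 n.-1) p.+1.
have sub2Q : I2 `<=` Q p.+1.
  move=> f' If'; apply: special_ideal_minor; apply: minor_idealS If' => r.
  by rewrite mem12 mem_iota2; lia.
apply: (@nzd_retract _ _ I1 I2 kappa t) => //.
- exact: minor_ideal_ideal.
- apply: coord_map_sub => // [|r l Hr Hl]; first by rewrite subrr.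
  case: ifP => [/andP[/eqP -> lp]|_]; last by rewrite subrr.
  by rewrite opprK addrC; apply: special_ideal_y; lia.
- apply: ideal_add_subset; first exact: (ideal_preimage kappa HW).
    apply: linear_ideal_subset; first exact: (ideal_preimage kappa HW).
    move=> l Hl /=; have [W0 _ _] := HW.
    rewrite (_ : kappa (yform l) = 0) //.
    rewrite /yform (rmorphD kappa) (rmorphM kappa) kt kz; try by lia.
    by rewrite kn // subrr.
  apply: minor_ideal_subset; first exact: (ideal_preimage kappa HW).
  move=> f' Hf inj_f /=; have [/existsP[a0 /eqP fa0]|] := boolP [exists a, f' a == n].
    have fne a : a != a0 -> (2 <= f' a < n)%N.
      move=> aa0; have := Hf a; rewrite mem_iota2.
      suff : f' a != n by lia.
      by apply: contra_neq aa0 => E; apply: inj_f; rewrite fa0.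
    pose f1 a := if a == a0 then 1%N else f' a.
    exists (- \det (zrows R n f1)).
      rewrite -mulN1r; apply: I1M; apply: minor_in_ideal => a; rewrite mem1 /f1.
      by case: eqVneq => [_|/fne]; lia.
    exists 0; first by have [] := minor_ideal_ideal R n (iota 2 n.-2) p.+1.
    rewrite addr0 mulrN (expand_det_row _ a0) (rmorph_sum kappa) (expand_det_row (zrows R n f1) a0).
    rewrite mulr_sumr -sumrN; apply: eq_bigr => l _.
    rewrite (rmorphM kappa) !mxE fa0 /f1 eqxx kn ?ltn_ord // mulNr mulrA.
    congr (- (_ * _)); apply: cofactor_zrows_map => a => [|b] aa0.
      by rewrite (negbTE aa0).
    by apply: kz; [have := fne _ aa0; lia|exact: ltn_ord].
  move=> /existsPn fn; exists 0; first by have [] := minor_ideal_ideal R n (iota 1 n.-1) p.+1.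
  have fne a : (2 <= f' a < n)%N by have := Hf a; have := fn a; rewrite mem_iota2; lia.
  exists (\det (zrows R n f')); first by apply: minor_in_ideal => a; rewrite mem12.
  rewrite mulr0 add0r; apply: det_zrows_map => a b; apply: kz; last exact: ltn_ord.
  by have := fne a; lia.
- have HC := ideal_colon t (Q_ideal p.+1).
  apply: minor_ideal_subset => // g Hg inj_g /=.
  have [/existsP[a0 /eqP ga0]|] := boolP [exists a, g a == 1%N]; last first.
    move=> /existsPn gn; apply: QM; apply: sub2Q; apply: minor_in_ideal => a.
    by have := Hg a; have := gn a; rewrite mem1 mem12; lia.
  pose g1 a := if a == a0 then n else g a.
  have Ecof l : cofactor (zrows R n g1) a0 l = cofactor (zrows R n g) a0 l.
    apply: (@cofactor_zrows_map _ _ _ idfun) => // a aa0.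
    by rewrite /g1 (negbTE aa0).
  (* Conversely, [t] times a minor through row 1, plus the minor with row [n] in its place, is a
     determinant whose row [a0] consists of the forms [yform]. *)
  have -> : t * \det (zrows R n g) =
      \sum_(l < p.+1) yform l.+1 * cofactor (zrows R n g) a0 l - \det (zrows R n g1).
    rewrite !(expand_det_row _ a0) mulr_sumr -sumrB; apply: eq_bigr => l _.
    by rewrite Ecof !mxE ga0 /g1 eqxx /yform; ring.
  apply: idealB => //.
    apply: ideal_sum => // l _; apply: idealMr => //.
    by apply: special_ideal_y; exact: ltn_ord.
  apply: special_ideal_minor; apply: minor_in_ideal => a; rewrite mem_iota2 /g1.
  case: eqVneq => [_|aa0]; first by lia.
  have := Hg a; rewrite mem1; suff : g a != 1%N by lia.
  by apply: contra_neq aa0 => E; apply: inj_g; rewrite ga0.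
- by apply: row_cofactor_map => a l; apply: kz; rewrite ?ltn_ord // /B; have := ltn_ord a; lia.
- exact: prime_nzd.
- exact: prime_nzd.
pose kappa0 := coord_map 0 z.
have k0z r l : (1 <= r <= n)%N -> (1 <= l <= n)%N -> kappa0 (z r l) = z r l.
  by move=> Hr Hl; rewrite Ctz_evalz.
apply: (@nzd_mod _ _ _ kappa0).
- apply: (@coord_map_sub _ _ _ _ [set f | exists g, f = t * g]).
  + exact: multiples_ideal.
  + by exists 1; rewrite subr0 mulr1.
  + by move=> r l _ _; exists 0; rewrite subrr mulr0.
- by rewrite Ctz_evalt.
- apply: row_cofactor_map => a l; rewrite k0z // /B; have := ltn_ord a; have := ltn_ord l; lia.
- by apply: minor_ideal_map => r l; rewrite mem12 => Hr Hl; rewrite k0z //; lia.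
- by apply: prime_nzd => // /sub12.
Qed.

Lemma twisted_prime s : (s <= p)%N -> is_prime (Q s).
Proof.
move=> sp.
apply: (@special_ideal_descend _ _ _ _ n B ord_max
  (fun l => - (t * z 1 l)) _ _ _ _ _ _ _ _ p.+1) => //.
- by lia.
- by apply: iota_in; lia.
- by rewrite mem_iota2; lia.
- by move=> a; rewrite mem_iota2 /B; have := ltn_ord a; lia.
- by right; split=> //; rewrite mem_iota2.
- by move=> l; rewrite opprK addrC.
- by move=> l; apply: yform_homogeneous; lia.
move=> {}s {}sp.
(* With [t = 1], row [n] zero and row 1 a basis vector, [yform s.+1] is the only one of the first
   [p.+1] forms not to vanish; column [p.+1] is zero on rows 2, ..., n, so the minors vanish. *)
pose x (r l : nat) : R[i] := if r == 1%N then (l == s.+1)%:R else basis_row r l.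
have xy l : (1 <= l <= p.+1)%N -> point R n 1 x (yform l) = (l == s.+1)%:R.
  move=> Hl; rewrite /yform (rmorphD (point R n 1 x)) (rmorphM (point R n 1 x)).
  rewrite Ctz_evalt !Ctz_evalz; try by lia.
  have n1 : (n == 1%N) = false by lia.
  have nB : (1 < n < p.+2)%N && (l.+1 == n) = false by lia.
  by rewrite /x /basis_row /= n1 nB mul1r addr0.
exists (point R n 1 x); split.
- apply: ideal_add_subset; first exact: ideal_preimage (ideal_zero_ideal _).
    apply: linear_ideal_subset; first exact: ideal_preimage (ideal_zero_ideal _).
    move=> l Hl /=; have ls : (l == s.+1) = false by lia.
    by rewrite xy ?ls //; lia.
  apply: basis_row_sum => r; rewrite mem_iota2; first by lia.
  move=> Hr; have r1 : (r == 1%N) = false by lia.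
  have rB : (1 < r < p.+2)%N && (p.+2 == r) = false by lia.
  by rewrite /x /basis_row r1 rB.
- apply: delta_point => r l Hr; have r1 : (r == 1%N) = false by lia.
  by rewrite /x r1.
- by rewrite xy ?eqxx ?oner_neq0 //; lia.
Qed.

End Rank.

(** This settles the case j = n, where K_n = 0: the forms generate the kernel of the substitution of
    [- (t * z 1 l)] for [z n l], [l <= s]. *)
Lemma linear_yform_prime s : (1 < n)%N -> (s <= n)%N -> is_prime (linear_ideal yform s).
Proof.
move=> n0 sn.
pose kappa := coord_map t (fun r l => if (r == n) && (l <= s)%N then - (t * z 1 l)
                                      else z r l).
have HI : is_ideal (linear_ideal yform s) by exact: ideal_gen_ideal.
have [I0 _ _] := HI.
suff -> : linear_ideal yform s = kappa @^-1` [set 0].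
  by apply: prime_preimage; exact: prime0.
apply/seteqP; split.
  apply: linear_ideal_subset; first exact: ideal_preimage (ideal_zero_ideal _).
  move=> l Hl /=; rewrite /yform (rmorphD kappa) (rmorphM kappa) Ctz_evalt.
  rewrite !Ctz_evalz; try by lia.
  have -> : (1%N == n) = false by lia.
  by rewrite eqxx (_ : (l <= s)%N) /= ?subrr //; lia.
move=> f /= kf; rewrite -[f]subr0 -kf; apply: coord_map_sub => // [|r l Hr Hl].
  by rewrite subrr.
case: ifP => [/andP[/eqP -> lp]|_]; last by rewrite subrr.
by rewrite opprK addrC; apply: linear_in_ideal; lia.
Qed.

End TwistedMinors.

(** * Decompositions and associated primes *)

Section Decompositions.
Variable A : comPzRingType.

Lemma big_ideal_add_mem (r : seq nat) (F : nat -> set A) i :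
    (forall j, is_ideal (F j)) -> i \in r ->
  F i `<=` \big[@ideal_add A/[set 0]]_(j <- r) F j.
Proof.
move=> HF; have HB s : is_ideal (\big[@ideal_add A/[set 0]]_(j <- s) F j).
  elim/big_ind: _ => //; first exact: ideal_zero_ideal.
  exact: ideal_add_ideal.
elim: r => // j r IHr; rewrite inE big_cons => /orP[/eqP ->|/IHr Fi] f Ff.
  by apply: ideal_addl.
by apply: ideal_addr => //; exact: Fi.
Qed.

Lemma big_ideal_add_subset (r : seq nat) (F : nat -> set A) (I : set A) :
    is_ideal I -> (forall i, i \in r -> F i `<=` I) ->
  \big[@ideal_add A/[set 0]]_(j <- r) F j `<=` I.
Proof.
move=> HI; elim: r => [|j r IHr] FI.
  by rewrite big_nil => _ ->; have [] := HI.
rewrite big_cons; apply: ideal_add_subset => //; first by apply: FI; rewrite inE eqxx.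
by apply: IHr => i ir; apply: FI; rewrite inE ir orbT.
Qed.

Lemma associated_primes_bigcap (C : set nat) (r : seq nat) (P : nat -> set A) :
    (forall i, C i -> i \in r) -> (forall i, C i -> is_prime (P i)) ->
    (forall i j, C i -> C j -> i != j -> exists2 x, P j x & ~ P i x) ->
  associated_primes (\bigcap_(i in C) P i) = [set P i | i in C].
Proof.
move=> Cr primeP incP; apply/seteqP; split.
  move=> Q [[HQ Q1 QM] [f QE]].
  have [[i [Ci nPf PQ]]|noP] :=
      pselect (exists i, [/\ C i, ~ P i f & P i `<=` Q]).
    exists i => //; apply/seteqP; split=> // g; rewrite QE => /(_ _ Ci).
    by have [_ _ PM] := primeP _ Ci => /PM [].
  (* Each [P i] not containing [f] has an element outside [Q]. The product of these elements lies
     outside [Q] but multiplies [f] into the intersection, a contradiction. *)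
  have [x nQx Px] : exists2 x, ~ Q x & forall i, i \in r -> C i -> P i (x * f).
    elim: (r) => [|i s [x nQx Px]]; first by exists 1.
    have [Ci|nCi] := pselect (C i); last first.
      by exists x => // j; rewrite inE => /orP[/eqP ->|/Px].
    have [[P0 PD PA] _ _] := primeP _ Ci.
    have [Pf|nPf] := pselect (P i f).
      exists x => // j; rewrite inE => /orP[/eqP -> _|/Px //].
      exact: PA.
    have [g Pg nQg] : exists2 g, P i g & ~ Q g.
      apply: contrapT => nex; apply: noP; exists i; split=> // g Pg.
      by apply: contrapT => nQg; apply: nex; exists g.
    exists (g * x); first by move=> /QM [].
    move=> j; rewrite inE => /orP[/eqP -> Cj|js Cj].
      by rewrite -mulrA mulrC; exact: PA.
    rewrite -mulrA; have [[_ _ PA'] _ _] := primeP _ Cj.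
    by apply: PA'; exact: Px.
  by case: nQx; rewrite QE => i Ci; apply: Px => //; exact: Cr.
move=> _ [i Ci <-]; split; first exact: primeP.
have [[P0 PD PA] P1 PM] := primeP _ Ci.
(* A product of elements of the other primes [P j], each chosen outside [P i]; the annihilator of
   its class is [P i]. *)
have [f nPf Pf] : exists2 f, ~ P i f & forall j, j \in r -> C j -> j != i -> P j f.
  elim: (r) => [|j s [f nPf Pf]]; first by exists 1.
  have [[Cj ij]|nC] := pselect (C j /\ i != j); last first.
    exists f => // j'; rewrite inE => /orP[/eqP -> Cj ij|/Pf //].
    by case: nC; split=> //; rewrite eq_sym.
  have [x Px nPx] := incP _ _ Ci Cj ij.
  exists (x * f); first by move=> /PM [].
  move=> j'; rewrite inE => /orP[/eqP -> _ _|js Cj' ij'].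
    by rewrite mulrC; have [[_ _ PA'] _ _] := primeP _ Cj; exact: PA'.
  by have [[_ _ PA'] _ _] := primeP _ Cj'; apply: PA'; exact: Pf.
exists f; apply/seteqP; split=> [g Pg j Cj|g /(_ _ Ci) /PM [] //].
have [->|ji] := eqVneq j i; first by rewrite mulrC; exact: PA.
have [[_ _ PA'] _ _] := primeP _ Cj.
by apply: PA'; apply: Pf => //; exact: Cr.
Qed.

(** If [u] kills [a ^+ k], then [u * a] is nilpotent, hence zero, and the same [u] shows that the
    fraction vanishes. The exponent [k.+1] in the proof covers [k = 0]. *)
Lemma reduced_Spec_quotient (I : ideal A) :
  (forall a k, ideal_set I (a ^+ k) -> ideal_set I a) -> reduced_Spec (quotient_ring I).
Proof.
move=> radI P _ a s k _ [u [nPu]]; rewrite mulr1 mul0r subr0 => uak.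
exists u; split=> //; rewrite mulr1 mul0r subr0.
have [HI0 _ HIM] := idealP I.
have classE x : quot_class I x = 0 <-> ideal_set I x.
  have class0 : quot_class I 0 = 0.
    by apply: (addrI (quot_class I 0)); rewrite -quot_classD !addr0.
  rewrite -class0; have := quot_classP I x 0; rewrite subr0; exact.
have classX x m : quot_class I (x ^+ m) = quot_class I x ^+ m.
  by elim: m => [//|m IHm]; rewrite !exprS quot_classM IHm.
rewrite -[u * a]quot_reprK; apply/classE; apply: (radI _ k.+1); apply/classE.
by rewrite classX quot_reprK exprMn exprSr exprS mulrACA uak mulr0.
Qed.

End Decompositions.

(** * Hessenberg ideals *)

Section HessenbergIdeals.
Variables (R : realType) (n : nat).
Hypothesis hn : (1 < n)%N.
Local Notation A := (Ctz R n).
Local Notation t := (tvar R n).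
Local Notation z := (zvar R n).
Local Notation yform := (yform R n).
Local Notation JKsum l j := (ideal_add (Jt R n l) (K R n j)).

Lemma Jt_ideal l : is_ideal (Jt R n l).
Proof. exact: ideal_gen_ideal. Qed.

Lemma K_ideal j : is_ideal (K R n j).
Proof. exact: ideal_gen_ideal. Qed.

Lemma JKsum_ideal l j : is_ideal (JKsum l j).
Proof. by apply: ideal_add_ideal; [exact: Jt_ideal|exact: K_ideal]. Qed.

Lemma K_top : K R n n = [set 0].
Proof. by rewrite -minor_ideal_K minor_ideal_small // size_iota; lia. Qed.

Lemma K_anti j j' : (j <= j')%N -> K R n j' `<=` K R n j.
Proof.
move=> /subnKC <-; elim: (_ - _)%N => [|m IHm]; first by rewrite addn0.
apply: subset_trans IHm; rewrite -!minor_ideal_K addnS.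
exact: minor_ideal_succ.
Qed.

Lemma Jt_mono l l' : (l <= l')%N -> Jt R n l `<=` Jt R n l'.
Proof.
move=> ll'; apply: linear_ideal_subset; first exact: Jt_ideal.
by move=> m Hm; apply: linear_in_ideal; lia.
Qed.

Lemma JtS l f : Jt R n l.+1 f ->
  exists2 q, Jt R n l q & exists g, f = q + yform l.+1 * g.
Proof.
have [J0 JD JM] := Jt_ideal l.
have HS : is_ideal [set f | exists2 q, Jt R n l q & exists g, f = q + yform l.+1 * g].
  split=> [|a b [q Jq [g ->]] [q' Jq' [g' ->]]|a b [q Jq [g ->]]].
  - by exists 0 => //; exists 0; rewrite mulr0 addr0.
  - by exists (q + q'); [exact: JD|exists (g + g'); ring].
  - by exists (a * q); [exact: JM|exists (a * g); ring].
apply: (linear_ideal_subset HS) => m Hm.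
have [ml|->] : (m <= l)%N \/ m = l.+1 by lia.
  exists (yform m); first by apply: linear_in_ideal; lia.
  by exists 0; rewrite mulr0 addr0.
by exists 0 => //; exists 1; rewrite mulr1 add0r.
Qed.

Lemma JKsum_prime l j : (l < j <= n)%N -> is_prime (JKsum l j).
Proof.
move=> lj; have [jn|jn] : j = n \/ (j < n)%N by lia.
  have -> : JKsum l j = Jt R n l.
    apply/seteqP; split; last by apply: ideal_addl; exact: K_ideal.
    apply: ideal_add_subset => //; first exact: Jt_ideal.
    by rewrite jn K_top => _ ->; have [] := Jt_ideal l.
  by apply: linear_yform_prime; lia.
case: j lj jn => [|p] lj jn; first by lia.
by rewrite -minor_ideal_K; apply: (@twisted_prime R n p _ l); lia.
Qed.

(* Evaluation at a point of the zero locus of [JKsum l j]: the [c]-th column of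
   the rows 2, ..., n vanishes for some [c <= j]. *)
Lemma JKsum_vanish l j c b x : (l <= n)%N -> (1 <= c <= j)%N -> (j <= n)%N ->
    (forall m, (1 <= m <= l)%N -> b * x 1%N m + x n m = 0) ->
    (forall r, (2 <= r <= n)%N -> x r c = 0) ->
  forall f, JKsum l j f -> point R n b x f = 0.
Proof.
move=> ln cj jn Hy Hc; apply: ideal_add_subset.
- exact: ideal_preimage (ideal_zero_ideal _).
- apply: linear_ideal_subset; first exact: ideal_preimage (ideal_zero_ideal _).
  move=> m Hm /=; rewrite (rmorphD (point R n b x)) (rmorphM (point R n b x)).
  by rewrite Ctz_evalt !Ctz_evalz ?Hy //; lia.
rewrite -minor_ideal_K; case: c cj Hc => [|c] cj Hc; first by lia.
have cj' : (c < j)%N by lia.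
apply: (@minor_ideal_vanish _ _ _ _ _ _ (fun l => (l == Ordinal cj')%:R) (Ordinal cj')).
  by rewrite eqxx oner_neq0.
move=> r; rewrite mem_iota2 => Hr; rewrite big1 // => m _.
have [->|_] := eqVneq m (Ordinal cj'); last by rewrite mulr0.
by rewrite Ctz_evalz /= ?Hc ?mul0r //; lia.
Qed.

Lemma yform_notin l m j : (l < m <= n)%N -> (1 <= j <= n)%N -> ~ JKsum l j (yform m).
Proof.
move=> lm Hj.
pose x (r c : nat) : R[i] := ((r == 1%N) && (c == m))%:R.
have n1 : (n == 1%N) = false by lia.
move=> /(@JKsum_vanish l j 1 1 x) E.
have : point R n 1 x (yform m) = 0.
  apply: E; try by lia.
  - move=> m' Hm'; rewrite /x /= n1 (_ : (m' == m) = false) ?mulr0 ?addr0 //; lia.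
  - by move=> r Hr; rewrite /x (_ : (r == 1%N) = false) //; lia.
rewrite (rmorphD (point R n 1 x)) (rmorphM (point R n 1 x)) Ctz_evalt.
rewrite !Ctz_evalz; try by lia.
by move=> /eqP; rewrite /x n1 !eqxx /= mulr1 addr0 oner_eq0.
Qed.

Lemma K_notin l j j' : (l < n)%N -> (j' < j <= n)%N ->
  exists2 f, K R n j' f & ~ JKsum l j f.
Proof.
move=> ln jj'; pose B (a : 'I_j') : nat := a.+2.
exists (\det (zrows R n B)).
  rewrite -minor_ideal_K; apply: minor_in_ideal => a; rewrite mem_iota2 /B.
  by have := ltn_ord a; lia.
(* With [t = - 1] and row 1 equal to row [n], all forms vanish; column [j] is zero because [j > j'],
   while the chosen minor is that of the identity. *)
pose e (r c : nat) : R[i] := ((c.+1 == r) && (r <= j'.+1)%N)%:R.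
pose x (r c : nat) : R[i] := if r == 1%N then e n c else e r c.
have n1 : (n == 1%N) = false by lia.
move=> /(@JKsum_vanish l j j (- 1) x) E.
have : point R n (- 1) x (\det (zrows R n B)) = 0.
  apply: E; try by lia.
  - by move=> m Hm; rewrite /x n1 /= mulN1r addNr.
  - move=> r Hr; have r1 : (r == 1%N) = false by lia.
    by rewrite /x r1 /e (_ : _ && _ = false) //; lia.
rewrite -det_map_mx (_ : map_mx _ _ = 1%:M).
  by rewrite det1 => /eqP; rewrite oner_eq0.
apply/matrixP => a b; have ap := ltn_ord a; have bp := ltn_ord b.
rewrite !mxE Ctz_evalz ?/B; try by lia.
rewrite /x /e /=; congr (nat_of_bool _)%:R; rewrite -[a == b]val_eqE /=.
by rewrite eq_sym; lia.
Qed.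

(** At [t = 0] and Z the identity, the determinant is 1, the forms [yform m] with [m < n] vanish,
    and so does the first column below its top entry. *)
Lemma zdet_notin l j : (l < j <= n)%N -> ~ JKsum l j (zdet R n).
Proof.
move=> lj; pose x (r c : nat) : R[i] := (r == c)%:R.
move=> /(@JKsum_vanish l j 1 0 x) E.
have : point R n 0 x (zdet R n) = 0.
  apply: E; try by lia.
  - by move=> m Hm; rewrite mul0r add0r /x (_ : (n == m) = false) //; lia.
  - by move=> r Hr; rewrite /x (_ : (r == 1%N) = false) //; lia.
rewrite -det_map_mx (_ : map_mx _ _ = 1%:M).
  by rewrite det1 => /eqP; rewrite oner_eq0.
apply/matrixP => a b; have ap := ltn_ord a; have bp := ltn_ord b.
by rewrite !mxE Ctz_evalz.
Qed.

(** The product of the ideals J_l and K_j. *)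
Definition JKprod l j : set A :=
  ideal_gen [set yform m * b | m in [set m | 1 <= m <= l]%N & b in K R n j].

Lemma JKprod_ideal l j : is_ideal (JKprod l j).
Proof. exact: ideal_gen_ideal. Qed.

Lemma JKprod_in l j m b : (1 <= m <= l)%N -> K R n j b -> JKprod l j (yform m * b).
Proof. by move=> Hm Kb; apply: sub_ideal_gen; exists m => //; exists b. Qed.

Lemma JKprod_subset l j (I : set A) : is_ideal I ->
    (forall m b, (1 <= m <= l)%N -> K R n j b -> I (yform m * b)) ->
  JKprod l j `<=` I.
Proof. by move=> HI Im; apply: ideal_gen_subset => // _ [m Hm [b Kb <-]]; exact: Im. Qed.

Lemma JKprod_mono l l' j : (l <= l')%N -> JKprod l j `<=` JKprod l' j.
Proof.
move=> ll'; apply: JKprod_subset; first exact: JKprod_ideal.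
by move=> m b Hm Kb; apply: JKprod_in => //; lia.
Qed.

(* [yform 1, ..., yform j] is a regular sequence modulo [K j]. *)
Lemma Jt_capK l j : (l <= j)%N -> (1 <= j <= n)%N ->
  forall f, Jt R n l f -> K R n j f -> JKprod l j f.
Proof.
move=> lj Hj; have [_ KD KM] := K_ideal j.
elim: l lj => [|l IHl] lj f Jf Kf.
  have -> : f = 0.
    by apply: (@linear_ideal_subset _ _ yform 0 [set 0]) Jf => [|m]; [exact: ideal_zero_ideal|lia].
  by have [] := JKprod_ideal 0 j.
have [q Jq [g Ef]] := JtS Jf.
have [_ _ PM] : is_prime (JKsum l j) by apply: JKsum_prime; lia.
(* [yform l.+1 * g = f - q] lies in the prime J_l + K_j, which omits [yform l.+1]. So g = a + b with
   a in J_l and b in K_j, and [f - yform l.+1 * b] remains in both J_l and K_j. *)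
have [|/(@yform_notin _ _ _)|[a Ja [b Kb Eg]]] := PM (yform l.+1) g.
- have -> : yform l.+1 * g = f - q by rewrite Ef; ring.
  apply: idealB; first exact: JKsum_ideal.
    by apply: ideal_addr; first exact: Jt_ideal.
  by apply: ideal_addl; first exact: K_ideal.
- by case; lia.
have [_ JKD _] := JKprod_ideal l.+1 j.
have -> : f = (f - yform l.+1 * b) + yform l.+1 * b by ring.
apply: JKD; last by apply: JKprod_in => //; lia.
apply: (JKprod_mono (leqnSn l)); apply: IHl; first by lia.
  rewrite Ef -Eg (_ : _ - _ = q + yform l.+1 * a); last by ring.
  by have [_ JD JM] := Jt_ideal l; apply: JD => //; exact: JM.
exact: idealB (K_ideal j) Kf (KM _ _ Kb).
Qed.

(** The first row of s_t is (t, 0, ..., 0, 1) and its other rows are zero. *)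
Lemma st_mul_zcols i (a : 'I_n) (b : 'I_i) :
  (map_mx (@Ct_in_Ctz R n) (st R n) *m zcols R n i) a b =
    if a == 0%N :> nat then yform b.+1 else 0.
Proof.
have CtD p q : Ct_in_Ctz n (p + q) = Ct_in_Ctz n p + Ct_in_Ctz n q :> Ctz R n.
  by rewrite /Ct_in_Ctz rmorphD hornerD.
have Ctn (m : bool) : Ct_in_Ctz n m%:R = m%:R :> Ctz R n.
  by rewrite /Ct_in_Ctz rmorph_nat; case: m; rewrite ?hornerE.
have CtX (m : bool) : Ct_in_Ctz n ('X * (m%:R)%:P) = t *+ m.
  rewrite /Ct_in_Ctz; case: m; rewrite ?polyC0 ?polyC1 ?mulr1 ?mulr0.
    by rewrite map_polyX hornerX.
  by rewrite map_poly0 horner0.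
have [o0 o0E] : exists o : 'I_n, o = 0%N :> nat.
  by have n0 : (0 < n)%N by [lia]; exists (Ordinal n0).
have [o1 o1E] : exists o : 'I_n, o = n.-1 :> nat.
  by have n1 : (n.-1 < n)%N by [lia]; exists (Ordinal n1).
have Cts c : Ct_in_Ctz n (st R n a c) =
    t *+ ((a == 0%N :> nat) && (c == o0)) + ((a == 0%N :> nat) && (c == o1))%:R.
  rewrite !mxE CtD Ctn; congr (_ + (_ && _)%:R); last first.
    by rewrite -val_eqE /= o1E; lia.
  have -> (u v : bool) : u%:R *+ v = (u && v)%:R :> R[i] by case: u; case: v.
  rewrite CtX; congr (_ *+ nat_of_bool _).
  by rewrite -!val_eqE /= o0E; case: eqP => //= ->; rewrite eq_sym.
rewrite mxE; under eq_bigr => c _ do rewrite mxE Cts mxE.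
case: eqVneq => /= a0; last by rewrite big1 // => c _; rewrite mulr0n add0r mul0r.
under eq_bigr => c _ do rewrite mulrDl.
rewrite big_split /= (bigD1 o0) //= eqxx mulr1n big1 ?addr0 => [|c /negbTE ->]; last first.
  by rewrite mulr0n mul0r.
rewrite (bigD1 o1) //= eqxx mul1r big1 ?addr0 => [|c /negbTE ->]; last by rewrite mul0r.
by rewrite o0E o1E prednK //; lia.
Qed.

(* A nonzero minor of [x v_1 ... x v_i v_1 ... v_j] of size [j + 1] uses exactly
   one of the first [i] columns, which are multiples of [e_1], and all of the
   others; hence it is some [yform m] times a generator of [K j]. *)
Lemma minors_hess_shape i j (M : 'M[A]_(n, i + j)) : (1 <= i <= n)%N -> (1 <= j < n)%N ->
    (forall (a : 'I_n) (b : 'I_(i + j)), (b < i)%N ->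
       M a b = if a == 0%N :> nat then yform b.+1 else 0) ->
    (forall (a : 'I_n) (b : 'I_(i + j)) (c : nat), b = (i + c)%N :> nat ->
       M a b = z a.+1 c.+1) ->
  ideal_gen (minors j.+1 M) = JKprod i j.
Proof.
move=> Hi Hj Ml Mr; have HJ := JKprod_ideal i j; have [J0 _ JM] := HJ.
apply/seteqP; split.
  apply: ideal_gen_subset => // _ [rows [cols [incr incc ->]]].
  have colsS (a b : 'I_j.+1) : (a < b)%N -> (cols a + (b - a) <= cols b)%N.
    elim: {b}(val b) {-2}b (erefl (val b)) => [|m IHm] b Eb ab; first by rewrite Eb in ab.
    have mj : (m < j.+1)%N by have := ltn_ord b; rewrite /= in Eb; lia.
    have := incc (Ordinal mj) b; rewrite /= Eb => /(_ (ltnSn m)) lt_mb.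
    have [am|ma] := ltnP a m; last first.
      have Ea : a = Ordinal mj by apply: val_inj => /=; rewrite /= in Eb; lia.
      by move: lt_mb; rewrite -Ea /=; rewrite /= in Eb; lia.
    have := IHm (Ordinal mj) erefl am; rewrite /=; rewrite /= in Eb; lia.
  case: j M Hj HJ J0 JM Ml Mr rows cols incr incc colsS => [|j] M; first by lia.
  move=> Hj HJ J0 JM Ml Mr rows cols incr incc colsS.
  (* The minor has one column more than the second block, so its first column comes from the first
     block. *)
  have c0i : (cols ord0 < i)%N.
    have := colsS ord0 ord_max isT; have := ltn_ord (cols ord_max); rewrite /=; lia.
  have rows_gt0 a : (0 < rows (lift ord0 a))%N.
    by apply: leq_ltn_trans (leq0n (rows ord0)) _; exact: incr.
  rewrite (expand_det_col _ ord0) big_ord_recl big1 ?addr0 => [|a _]; last first.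
    by rewrite mxE Ml // gtn_eqF ?mul0r.
  rewrite mxE Ml //; case: eqVneq => [r0|_]; last by rewrite mul0r.
  rewrite /cofactor add0n mul1r.
  (* Two columns from the first block are both multiples of e_1, and the minor is zero. *)
  have [c1i|ic1] := ltnP (cols (lift ord0 ord0)) i.
    rewrite (expand_det_col _ ord0) big1 ?mulr0 // => a _.
    by rewrite !mxE Ml // gtn_eqF ?mul0r.
  have colsE (b : 'I_j.+1) : cols (lift ord0 b) = (i + b)%N :> nat.
    have := ltn_ord (cols ord_max); have [bm|bm] : b = j :> nat \/ (b < j)%N.
    - by have := ltn_ord b; lia.
    - have -> : lift ord0 b = ord_max by apply: ord_inj; rewrite lift0 /= bm.
      have [j0|j0] := posnP j.
        have <- : lift ord0 ord0 = ord_max :> 'I_j.+2 by apply: ord_inj; rewrite lift0 /= j0.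
        by lia.
      by have := colsS (lift ord0 ord0) ord_max; rewrite lift0 ltnS => /(_ j0) /=; lia.
    have := colsS (lift ord0 b) ord_max; rewrite lift0 ltnS => /(_ bm) /=.
    have [b0|b0] := posnP b; last first.
      by have := colsS (lift ord0 ord0) (lift ord0 b); rewrite !lift0 ltnS => /(_ b0) /=; lia.
    have -> : b = ord0 by exact: val_inj.
    by rewrite /=; lia.
  apply: JKprod_in; first by lia.
  rewrite (_ : row' _ _ = zrows R n (fun a => (rows (lift ord0 a)).+1)).
    rewrite -minor_ideal_K; apply: minor_in_ideal => a.
    by rewrite mem_iota2 ltnS rows_gt0 ltn_ord.
  by apply/matrixP => a b; rewrite !mxE; apply: Mr; exact: colsE.
apply: JKprod_subset; first exact: ideal_gen_ideal.
move=> m b Hm; have HG := ideal_gen_ideal (minors j.+1 M).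
apply: (@ideal_gen_subset _ _ [set b | ideal_gen (minors j.+1 M) (yform m * b)]) => {b}.
  exact: ideal_colon.
move=> _ [B [sB HB szB] <-] /=.
have Bin k : (k < j)%N -> (2 <= nth 0%N B k <= n)%N.
  by move=> kj; apply: HB; apply: mem_nth; rewrite szB.
(* Conversely, row 1 is put in front of the rows [B] and column [m] in front of the second block;
   [.-1] passes to 0-based numbering. *)
pose r k := if k is k'.+1 then (nth 0%N B k').-1 else 0%N.
pose c k := if k is k'.+1 then (i + k')%N else m.-1.
have rn (a : 'I_j.+1) : (r a < n)%N.
  by case: a => [[|k] kj] /=; [lia|have := Bin k kj; lia].
have cij (a : 'I_j.+1) : (c a < i + j)%N by case: a => [[|k] kj] /=; lia.
apply: sub_ideal_gen; exists (fun a => Ordinal (rn a)), (fun a => Ordinal (cij a)); split.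
- move=> [[|a] aj] [[|b] bj] //= ab; first by have := Bin b bj; lia.
  have /= := sorted_ltn_nth ltn_trans 0%N sB a b.
  by rewrite !inE szB => /(_ aj bj ab); have := Bin a aj; have := Bin b bj; lia.
- by move=> [[|a] aj] [[|b] bj] //= ab; lia.
rewrite (expand_det_col _ ord0) big_ord_recl big1 ?addr0 => [|a _]; last first.
  rewrite mxE Ml /=; last by lia.
  by case: (nth 0%N B a) (Bin a (ltn_ord a)) => [|[|q]] //= _; rewrite mul0r.
rewrite mxE Ml /=; last by lia.
rewrite prednK; last by lia.
congr (_ * _); rewrite /cofactor add0n mul1r /pB; clear -Mr szB Bin; subst j.
congr (\det _); apply/matrixP => a b; rewrite !mxE (Mr _ _ b) //=.
Qed.

Lemma minors_hess_matrix i j : (1 <= i <= n)%N -> (1 <= j < n)%N ->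
  ideal_gen (minors j.+1 (hess_matrix (st R n) i j)) = JKprod i j.
Proof.
move=> Hi Hj; apply: minors_hess_shape => // a b; last first.
  move=> c bE; have cj : (c < j)%N by have := ltn_ord b; lia.
  have -> : b = rshift i (Ordinal cj) by exact: val_inj.
  by rewrite /hess_matrix row_mxEr mxE.
move=> bi; have -> : b = lshift j (Ordinal bi) by exact: val_inj.
by rewrite /hess_matrix row_mxEl st_mul_zcols.
Qed.

End HessenbergIdeals.
Arguments JKprod : clear implicits.

(** * The intersection formula and its consequences *)

Section Theorem6p2.
Variables (R : realType) (n : nat).
Hypothesis hn : (1 < n)%N.
Variable h : nat -> nat.
Hypothesis hh : hessenberg n h.
Local Notation A := (Ctz R n).
Local Notation P := (Pt R n h).

Let h_range i : (1 <= i <= n)%N -> (i <= h i <= n)%N.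
Proof.
move=> Hi; have [_ h1 _ h2] := hh.
by have := h1 _ Hi; have := h2 _ Hi; lia.
Qed.

Let h_mono i j : (1 <= i <= j)%N -> (j <= n)%N -> (h i <= h j)%N.
Proof.
have [_ _ hS _] := hh => /andP[i1 ij]; rewrite -(subnKC ij).
elim: (j - i)%N => [|m IHm] mn; first by rewrite addn0.
by rewrite addnS; apply: leq_trans (hS _ _); [apply: IHm; lia|lia].
Qed.

Let P_ideal i : is_ideal (P i).
Proof. exact: JKsum_ideal. Qed.

Let P_prime i : (1 <= i <= n)%N -> is_prime (P i).
Proof. by move=> Hi; apply: JKsum_prime => //; have := h_range Hi; lia. Qed.

Lemma hess_ideal_at_JKprod i : (1 <= i <= n)%N ->
  hess_ideal_at (st R n) h i = JKprod R n i (h i).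
Proof.
move=> Hi; have := h_range Hi; rewrite /hess_ideal_at; case: ltnP => hin Hh.
  by apply: minors_hess_matrix => //; lia.
have -> : h i = n by lia.
apply/seteqP; split=> [_ ->|]; first by have [] := JKprod_ideal R n i n.
apply: JKprod_subset; first exact: ideal_zero_ideal.
by move=> m b _; rewrite K_top // => ->; rewrite mulr0.
Qed.

Lemma hess_ideal_is_ideal : is_ideal (hess_ideal (st R n) h).
Proof.
rewrite /hess_ideal; elim/big_ind: _ => [||i _].
- exact: ideal_zero_ideal.
- exact: ideal_add_ideal.
- exact: hess_ideal_at_ideal.
Qed.

Lemma JKprod_sub_hess i : (1 <= i <= n)%N ->
  JKprod R n i (h i) `<=` hess_ideal (st R n) h.
Proof.
move=> Hi; rewrite -hess_ideal_at_JKprod //; apply: big_ideal_add_mem.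
  exact: hess_ideal_at_ideal.
by rewrite mem_index_iota; lia.
Qed.

(** If [c <= i], then K_(h(i)) lies in K_(h(c)); otherwise J_i lies in J_(c-1). *)
Lemma JKprod_sub_P i c : (1 <= i <= n)%N -> (1 <= c <= n)%N ->
  JKprod R n i (h i) `<=` P c.
Proof.
move=> Hi Hc; apply: JKprod_subset; first exact: P_ideal.
move=> m b Hm Kb; have [ci|ic] := leqP c i.
  apply: ideal_addr; first exact: Jt_ideal.
  have [_ _ KM] := K_ideal R n (h c); apply: KM; apply: K_anti Kb.
  by apply: h_mono; lia.
apply: ideal_addl; first exact: K_ideal.
apply: (idealMr _ (Jt_ideal R n c.-1)).
by apply: (@linear_in_ideal R n (yform R n)); lia.
Qed.

Lemma hess_ideal_sub_P c : (1 <= c <= n)%N -> hess_ideal (st R n) h `<=` P c.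
Proof.
move=> Hc; apply: big_ideal_add_subset; first exact: P_ideal.
move=> i; rewrite mem_index_iota => Hi.
by rewrite hess_ideal_at_JKprod; [apply: JKprod_sub_P|]; lia.
Qed.

(** If [i.+1] is not a corner, then h(i+1) = h(i) and [P i] lies in [P i.+1]. The index 1 is always
    a corner, since [h 0 = 0]. *)
Lemma bigcap_corners f : (\bigcap_(c in corners n h) P c) f ->
  forall i, (1 <= i <= n)%N -> P i f.
Proof.
move=> Pf; elim=> [|i IHi] Hi; first by lia.
have [h0 h1 hS _] := hh.
have [lt|ge] := ltnP (h i) (h i.+1); first by apply: Pf; split.
have i0 : (0 < i)%N by case: i ge Hi {IHi} => // ge Hi; have := h1 1%N; lia.
have hE : h i.+1 = h i by have := hS i; lia.
have [|a Ja [b Kb <-]] := IHi _; first by lia.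
exists a; first by apply: Jt_mono Ja => /=; lia.
by exists b => //; rewrite hE.
Qed.

(* Modular law along the chains [J_i] (increasing) and [K_(h i)] (decreasing). *)
Lemma bigcap_P_hess f : (forall i, (1 <= i <= n)%N -> P i f) ->
  hess_ideal (st R n) h f.
Proof.
move=> Pf; have [H0 HD HM] := hess_ideal_is_ideal.
suff main i : (1 <= i <= n)%N -> exists2 q,
    hess_ideal (st R n) h q & K R n (h i) (f - q).
  have [|q Hq] := main n; first by lia.
  have -> : h n = n by have := @h_range n; lia.
  by rewrite K_top // => Eq; rewrite -[f](subrK q) Eq add0r.
elim: i => [|i IHi] Hi; first by lia.
have [i0|i0] := posnP i.
  have [a Ja [b Kb Ef]] := Pf i.+1 Hi; exists 0 => //.
  rewrite subr0 -Ef (_ : a = 0) ?add0r //.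
  rewrite i0 /= in Ja; apply: (@linear_ideal_subset _ _ (yform R n) 0 [set 0]) Ja.
    exact: ideal_zero_ideal.
  by move=> m; lia.
have [|q Hq Kq] := IHi; first by lia.
have [a Ja [b Kb Eab]] : P i.+1 (f - q).
  by apply: idealB; [exact: P_ideal|exact: Pf|exact: hess_ideal_sub_P Hq].
(* [a = (f - q) - b] lies in both J_i and K_(h(i)), hence in their product. *)
exists (q + a).
  apply: HD => //; apply: (@JKprod_sub_hess i); first by lia.
  apply: Jt_capK => //; try by have := @h_range i; lia.
  have -> : a = (f - q) - b by rewrite -Eab addrK.
  apply: (idealB (K_ideal R n (h i)) Kq); apply: K_anti Kb.
  by apply: h_mono; lia.
by rewrite opprD addrA -Eab addrAC subrr add0r.
Qed.

Lemma hess_ideal_bigcap : hess_ideal (st R n) h = \bigcap_(i in corners n h) P i.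
Proof.
apply/seteqP; split=> [f Hf c [Hc _]|f Pf]; first exact: hess_ideal_sub_P Hf.
by apply: bigcap_P_hess => i; exact: bigcap_corners.
Qed.

Lemma hess_ideal_nzd f :
  hess_ideal (st R n) h (zdet R n * f) -> hess_ideal (st R n) h f.
Proof.
rewrite hess_ideal_bigcap => Hf c Cc; have [Hc _] := Cc.
have [_ _ PM] := P_prime Hc; have [/zdet_notin|//] := PM _ _ (Hf c Cc).
by case=> //; have := h_range Hc; lia.
Qed.

Lemma hess_ideal_radical f k :
  hess_ideal (st R n) h (f ^+ k) -> hess_ideal (st R n) h f.
Proof.
rewrite hess_ideal_bigcap => Hf c Cc; have [Hc _] := Cc.
exact: primeX (P_prime Hc) (Hf c Cc).
Qed.

(** If [i < j], then [yform j.-1] lies in J_(j-1) but not in [P i]. If [j < i], the corner [i] gives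
    [h j < h i], and a minor of size [h j] lies outside [P i]. *)
Lemma corners_incomparable i j : corners n h i -> corners n h j -> i != j ->
  exists2 x, P j x & ~ P i x.
Proof.
move=> [Hi ci] [Hj cj] ij; have [lt|ge] := ltnP i j.
  exists (yform R n j.-1).
    apply: ideal_addl; first exact: K_ideal.
    by apply: linear_in_ideal; lia.
  by apply: yform_notin => //; have := h_range Hi; lia.
have lt_h : (h j < h i)%N.
  by apply: leq_ltn_trans ci; apply: h_mono; lia.
have [||x Kx nx] := @K_notin R n hn i.-1 (h i) (h j); first by lia.
  by have := h_range Hi; lia.
by exists x => //; apply: ideal_addr => //; exact: Jt_ideal.
Qed.

End Theorem6p2.

Theorem theorem6p2 (R : realType) (n : nat) (hn : (2 <= n)%N)
    (h : nat -> nat) (hh : hessenberg n h) :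
  [/\ hess_ideal (st R n) h = \bigcap_(i in corners n h) Pt R n h i,
      hess_ideal_sat (st R n) h = hess_ideal (st R n) h,
      reduced_Spec (hess_coord_ring (st R n) h)
    & associated_primes (hess_ideal_sat (st R n) h)
      = [set Pt R n h i | i in corners n h] ].
Proof.
have capE := hess_ideal_bigcap R hn hh.
have satE : hess_ideal_sat (st R n) h = hess_ideal (st R n) h.
  by apply: ideal_sat_nzd; exact: hess_ideal_nzd.
split=> //.
  apply: reduced_Spec_quotient => a k /=; rewrite satE.
  exact: hess_ideal_radical.
rewrite satE capE.
apply: (@associated_primes_bigcap _ _ (iota 1 n)) => [i [Hi _]|i [Hi _]|i j].
- by rewrite mem_iota; lia.
- by apply: JKsum_prime => //; have [_ /(_ i Hi) + _ /(_ i Hi)] := hh; lia.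
- exact: corners_incomparable.
Qed.
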